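(* Let $\Omega$ be an open set in $\mathbb R^n$, $n\ge 2$, and let $\phi:\Omega\to\mathbb R$ with $\phi\in W^{1,n}_{loc}(\Omega)$. Then the exponential $e^{\phi}$ vanishes to finite order in the $L^2$ sense at each point of $\Omega$.
   Context: A function $u\in L^2_{loc}(\Omega)$ vanishes to infinite order at $x_0\in\Omega$ in the $L^2$ sense if for all $m\ge 0$, $\lim_{r\to0}r^{-m}\int_{|x-x_0|<r}|u(x)|^2\,dv=0$, where $dv$ is Lebesgue measure; otherwise $u$ vanishes to finite order at $x_0$ in the $L^2$ sense. (The notion applies to functions in $L^2_{loc}(\Omega)$, so the assertion includes $e^\phi\in L^2_{loc}(\Omega)$.) $W^{1,n}_{loc}(\Omega)$ is the standard local Sobolev space. *)

(* Defs.v *)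
From HB Require Import structures.
From mathcomp Require Import all_boot all_order all_algebra.
From mathcomp Require Import all_classical all_reals all_analysis.

Set Implicit Arguments.
Unset Strict Implicit.
Unset Printing Implicit Defensive.

Import Order.TTheory GRing.Theory Num.Theory.
Import numFieldNormedType.Exports.

Local Open Scope classical_set_scope.
Local Open Scope ring_scope.

(* The library's sigma-finiteness instance on m1 \x m2 is shadowed by the one
   for subprobabilities, hence is not found by inference. *)
Lemma sigma_finite_product d1 d2 (T1 : measurableType d1)
    (T2 : measurableType d2) (R : realType)
    (m1 : {sigma_finite_measure set T1 -> \bar R})
    (m2 : {sigma_finite_measure set T2 -> \bar R}) :
  sigma_finite setT (m1 \x m2)%E.
Proof.
have /sigma_finiteP[F [TF ndF Foo]] := sigma_finiteT m1.
have /sigma_finiteP[G [TG ndG Goo]] := sigma_finiteT m2.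
exists (fun k => F k `*` G k).
  rewrite -setXTT TF TG predeqE => -[x y]; split.
    move=> [/= [k _ Fkx] [l _ Gly]]; exists (maxn k l) => //; split.
    - by move: x Fkx; exact/subsetPset/ndF/leq_maxl.
    - by move: y Gly; exact/subsetPset/ndG/leq_maxr.
  by move=> [k _ []/= ? ?]; split; exists k.
move=> k; have [? ?] := Foo k; have [? ?] := Goo k.
split; first exact: measurableX.
by rewrite product_measure1E// lte_mul_pinfty// ge0_fin_numE.
Qed.

Section borel_product_measure.
Variable R : realType.
Local Notation mR := (measurableTypeR R).
Local Open Scope ereal_scope.

Definition tuple0_measure : set (0.-tuple mR) -> \bar R := \d_[tuple].

HB.instance Definition _ := Measure.on tuple0_measure.

Let tuple0_measure_sigma_finite : sigma_finite setT tuple0_measure.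
Proof.
apply: fin_num_fun_sigma_finite; first by rewrite measure0.
by move=> A mA; rewrite /tuple0_measure diracE.
Qed.

HB.instance Definition _ := Measure_isSigmaFinite.Build _ _ _ tuple0_measure
  tuple0_measure_sigma_finite.

Section tupleS.
Variable n : nat.

Definition cons_pair (p : mR * n.-tuple mR) : n.+1.-tuple mR :=
  [tuple of p.1 :: p.2].

Definition uncons_tuple (t : n.+1.-tuple mR) : mR * n.-tuple mR :=
  (thead t, [tuple of behead t]).

Lemma measurable_cons_pair : measurable_fun setT cons_pair.
Proof. exact: measurable_cons measurable_fst measurable_snd. Qed.

Lemma measurable_uncons_tuple : measurable_fun setT uncons_tuple.
Proof.
apply/measurable_fun_pairP; split.
  exact: (measurable_tnth (ord0 : 'I_n.+1)).
exact: measurable_behead.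
Qed.

Lemma cons_pairK : cancel cons_pair uncons_tuple.
Proof. by move=> [x t]; congr pair; apply/val_inj. Qed.

Variable m : {sigma_finite_measure set (n.-tuple mR) -> \bar R}.

Definition tupleS_measure : set (n.+1.-tuple mR) -> \bar R :=
  pushforward (@lebesgue_measure R \x m) cons_pair.

Let mpre A : measurable A -> measurable (cons_pair @^-1` A).
Proof.
by move=> mA; rewrite -[X in measurable X]setTI; exact: measurable_cons_pair.
Qed.

Let tupleS_measure0 : tupleS_measure set0 = 0.
Proof. by rewrite /tupleS_measure /pushforward preimage_set0 measure0. Qed.

Let tupleS_measure_ge0 A : 0 <= tupleS_measure A.
Proof. by rewrite /tupleS_measure /pushforward measure_ge0. Qed.

Let tupleS_measure_sigma_additive : semi_sigma_additive tupleS_measure.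
Proof.
move=> F mF tF mUF; rewrite /tupleS_measure /pushforward preimage_bigcup.
apply: measure_semi_sigma_additive.
- by move=> k; exact: mpre.
- apply/trivIsetP => /= i j _ _ ij; rewrite -preimage_setI.
  by move/trivIsetP : tF => /(_ _ _ _ _ ij) ->//; rewrite preimage_set0.
- by rewrite -preimage_bigcup; exact: mpre.
Qed.

HB.instance Definition _ := isMeasure.Build _ _ _ tupleS_measure
  tupleS_measure0 tupleS_measure_ge0 tupleS_measure_sigma_additive.

Let tupleS_measure_sigma_finite : sigma_finite setT tupleS_measure.
Proof.
have [F TF Foo] := sigma_finite_product (@lebesgue_measure R) m.
exists (fun k => uncons_tuple @^-1` F k).
  by rewrite -preimage_bigcup -TF preimage_setT.
move=> k; have [mF Fk] := Foo k; split.
  by rewrite -[X in measurable X]setTI; exact: measurable_uncons_tuple.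
rewrite /tupleS_measure /pushforward -comp_preimage.
by rewrite (_ : uncons_tuple \o cons_pair = id)//; exact/funext/cons_pairK.
Qed.

HB.instance Definition _ := Measure_isSigmaFinite.Build _ _ _ tupleS_measure
  tupleS_measure_sigma_finite.

End tupleS.

(* The n-fold product of the one-dimensional Lebesgue measure, on the product
   (Borel) sigma-algebra of the n-tuples. *)
Fixpoint tuple_measure n : {sigma_finite_measure set (n.-tuple mR) -> \bar R} :=
  match n with
  | 0 => tuple0_measure
  | k.+1 => tupleS_measure (tuple_measure k)
  end.

End borel_product_measure.

Section lebesgue_Rn.
Variables (R : realType) (n : nat).
Local Open Scope ereal_scope.

Definition row_of_tuple (t : n.-tuple (measurableTypeR R)) : 'rV[R]_n := \row_i tnth t i.

Definition lebesgue_outer (A : set 'rV[R]_n) : \bar R :=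
  ((tuple_measure R n)^*)%mu (row_of_tuple @^-1` A).

Let lebesgue_outer0 : lebesgue_outer set0 = 0.
Proof. by rewrite /lebesgue_outer preimage_set0 outer_measure0. Qed.

Let lebesgue_outer_ge0 A : 0 <= lebesgue_outer A.
Proof. exact: outer_measure_ge0. Qed.

Let le_lebesgue_outer : {homo lebesgue_outer : A B / A `<=` B >-> A <= B}.
Proof. by move=> A B AB; apply: le_outer_measure => x; exact: AB. Qed.

Let lebesgue_outer_sigma_subadditive : sigma_subadditive lebesgue_outer.
Proof.
move=> F; rewrite /lebesgue_outer preimage_bigcup.
exact: outer_measure_sigma_subadditive.
Qed.

HB.instance Definition _ := isOuterMeasure.Build R 'rV[R]_n lebesgue_outer
  lebesgue_outer0 lebesgue_outer_ge0 le_lebesgue_outer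
  lebesgue_outer_sigma_subadditive.

(* Measurability in R^n is Lebesgue measurability: the completion of the Borel
   sigma-algebra, obtained as the Caratheodory sets of the outer measure. *)
HB.instance Definition _ := Measurable.copy 'rV[R]_n
  (caratheodory_type lebesgue_outer).

Definition lebesgue_Rn : set 'rV[R]_n -> \bar R := lebesgue_outer.

HB.instance Definition _ := isMeasure.Build _ 'rV[R]_n R lebesgue_Rn
  (@caratheodory_measure0 _ _ lebesgue_outer)
  (@caratheodory_measure_ge0 _ _ lebesgue_outer)
  (@caratheodory_measure_sigma_additive _ _ lebesgue_outer).

End lebesgue_Rn.

Section sobolev.
Variables (R : realType) (n : nat).
Local Notation Rn := 'rV[R]_n.
Local Notation mu := (@lebesgue_Rn R n).
Implicit Types (V Omega : set Rn) (u g psi : Rn -> R) (i : 'I_n).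

(* The norm of 'rV[R]_n in the library is the sup norm. *)
Definition euclidean_ball (x0 : Rn) (r : R) : set Rn :=
  [set x | Num.sqrt (\sum_(i < n) (x ord0 i - x0 ord0 i) ^+ 2) < r].

Definition partial i u : Rn -> R := fun x => 'D_(delta_mx ord0 i) u x.

Definition smooth u := forall s : seq 'I_n,
  let v := foldr partial u s in
  continuous v /\ forall i x, derivable v x (delta_mx ord0 i).

(* C_c^oo(V), its elements being extended by 0 outside of V. *)
Definition test_function V psi :=
  smooth psi /\
  exists K : set Rn, [/\ compact K, K `<=` V & forall x, ~ K x -> psi x = 0].

(* Functions on V are total functions of which only the values in V matter. *)
Definition Lp V (p : R) u := u \_ V \in Lfun mu p%:E.

Definition weak_partial V i u g := forall psi, test_function V psi ->
  \int[mu]_(x in V) (u x * partial i psi x) =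
  - \int[mu]_(x in V) (g x * psi x).

Definition W1p V (p : R) u :=
  Lp V p u /\ forall i, exists2 g, Lp V p g & weak_partial V i u g.

Definition compactly_contained V Omega :=
  compact (closure V) /\ closure V `<=` Omega.

Definition Lp_loc Omega p u :=
  forall V, open V -> compactly_contained V Omega -> Lp V p u.

Definition W1p_loc Omega p u :=
  forall V, open V -> compactly_contained V Omega -> W1p V p u.

Definition vanishes_to_infinite_order Omega u (x0 : Rn) := forall m : nat,
  ((r ^- m)%:E *
   \int[mu]_(x in Omega `&` euclidean_ball x0 r) (`|u x| ^+ 2)%:E)%E
    @[r --> (0 : R)^'+] --> 0%E.

Definition vanishes_to_finite_order Omega u (x0 : Rn) :=
  ~ vanishes_to_infinite_order Omega u x0.

End sobolev.

(* Main.v *)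
Require Import Defs.
From mathcomp Require Import all_boot all_order all_algebra.
From mathcomp Require Import all_classical all_reals all_analysis.
From mathcomp Require Import measurable_realfun ring lra.
Import Order.TTheory GRing.Theory Num.Theory.
Import numFieldNormedType.Exports.
Set Implicit Arguments.
Unset Strict Implicit.
Unset Printing Implicit Defensive.
Local Open Scope classical_set_scope.
Local Open Scope ring_scope.

(** On a box [B] with sides [l_i] let [V_B] be the average of [phi] and
    [D(B) = sum_i l_i avg_B |d_i phi|].  Testing the weak derivative against
    a product of cutoffs and a tent shows that halving [B] in direction [i]
    gives halves whose averages differ by at most [x = l_i avg_B |d_i phi|],
    while the mean of [D] over the two halves is [D(B) - x / 2].  Hence
    [e^(c V_B) (1 + 4 c D(B))] does not increase in the mean under halving as
    long as [4 c D <= 1].  Always halving a longest side keeps the boxes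
    balanced, so [D(B)] is controlled by the integral of [|grad phi|^n] over
    [B], which is small on small cubes: this is where the exponent [n] enters.
    Thus [phi] has exponential tails of arbitrary rate on small cubes, and
    [e^(2 phi)] and [e^(-2 phi)] are locally integrable; by Cauchy-Schwarz the
    latter bounds the integral of [e^(2 phi)] over the ball of radius [r] from
    below by a multiple of [r^(2n)]. *)

(** * Smooth functions on the line *)

(** The obstacle is to bound an integral of an exponential that is not known in advance to be
    finite, from estimates on cell averages only. By convexity [expR] lies above its tangent lines,
    and the mean over a cell of a tangent of [expR] composed with [c * phi] is the tangent at the
    cell average, hence at most [e^(c V_B)]. The halving estimate thus controls the integral of any
    tangent over any union of cells, with a constant independent of the depth. Such unions are dense
    in measure, so absolute continuity carries the bound to every measurable set, in particular to
    the level sets of [phi], on which a suitable tangent is large. This takes the place of almost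
    everywhere convergence of cell averages.

    The factor [1 + 4 c D] is there because each half average is only bounded by [V_B + x / 2], so
    that a halving may cost a factor [e^(c x / 2)], and the number of halvings is unbounded. The
    drop of the mean of [D] by [x / 2] pays for that loss, so nothing accumulates. *)

Section smooth_line.
Variable R : realType.
Implicit Types (f g : R -> R) (k : nat).

(** Derivatives are existential witnesses, so each closure property is an induction on [k] that only
    has to supply the formula of the derivative. *)
Fixpoint Cn k f : Prop :=
  if k is k'.+1 then exists2 f' : R -> R, forall x : R, is_derive x 1 f (f' x) & Cn k' f'
  else continuous f.

Definition smooth1 f := forall k, Cn k f.

Lemma is_derive_continuous f (f' : R -> R) :
  (forall x : R, is_derive x 1 f (f' x)) -> continuous f.
Proof.
move=> df x; apply/differentiable_continuous/derivable1_diffP.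
by have [] := df x.
Qed.

Lemma CnW k f : Cn k.+1 f -> Cn k f.
Proof.
elim: k f => [|k IH] f [f' df Cf']; first exact: is_derive_continuous df.
by exists f' => //; exact: IH.
Qed.

Lemma smooth1_continuous f : smooth1 f -> continuous f.
Proof. by move=> /(_ 0%N). Qed.

Lemma CnD k f g : Cn k f -> Cn k g -> Cn k (fun x => f x + g x).
Proof.
elim: k f g => [|k IH] f g.
  by move=> cf cg x; apply: cvgD; [exact: cf|exact: cg].
move=> [f' df Cf'] [g' dg Cg']; exists (fun x => f' x + g' x); last exact: IH.
by move=> x; have := df x; have := dg x; move=> ? ?; exact: is_deriveD.
Qed.

Lemma CnM k f g : Cn k f -> Cn k g -> Cn k (fun x => f x * g x).
Proof.
elim: k f g => [|k IH] f g.
  by move=> cf cg x; apply: cvgM; [exact: cf|exact: cg].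
move=> Cf Cg; have := Cf; have := Cg.
move=> [g' dg Cg'] [f' df Cf']; exists (fun x => f x * g' x + g x * f' x).
  by move=> x; have := df x; have := dg x; move=> ? ?; exact: is_deriveM.
by apply: CnD; apply: IH => //; exact: CnW.
Qed.

Lemma Cn_cst k (c : R) : Cn k (fun=> c).
Proof.
elim: k c => [|k IH] c; first by move=> x; exact: cvg_cst.
by exists (fun=> 0) => // x; exact: is_derive_cst.
Qed.

Lemma Cn_comp_affine k f (a b : R) : Cn k f -> Cn k (fun x => f (a * x + b)).
Proof.
elim: k f => [|k IH] f.
  move=> cf x; apply: (@continuous_comp _ _ _ (fun x => a * x + b) f); last exact: cf.
  by apply: cvgD; [apply: cvgM; [exact: cvg_cst|exact: cvg_id]|exact: cvg_cst].
move=> [f' df Cf']; exists (fun x => a * f' (a * x + b)); last first.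
  by apply: CnM; [exact: Cn_cst|exact: IH].
move=> x.
have h : is_derive x 1 (fun x => a * x + b) a.
  by apply: is_derive_eq; rewrite /GRing.scale/=; ring.
rewrite mulrC; have := df (a * x + b); move=> h'.
exact: (is_derive1_comp (f := f) (g := fun x => a * x + b)).
Qed.

Lemma smooth1_derive f f' : (forall x : R, is_derive x 1 f (f' x)) ->
  smooth1 f <-> smooth1 f'.
Proof.
move=> df; split=> sf k; last first.
  by apply: CnW; exists f'.
have [g dg Cg] := sf k.+1.
suff -> : f' = g by [].
by apply/funext => x; have [_ <-] := df x; have [_ <-] := dg x.
Qed.

(** The classical flat function is [flat 0]. The powers are included to close the family under
    differentiation: the derivative of [flat k] is a combination of [flat k.+1] and [flat k.+2]. *)
Definition flat k (t : R) : R := if 0 < t then t ^- k * expR (- t^-1) else 0.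

Lemma flat_ge0 k t : 0 <= flat k t.
Proof.
by rewrite /flat; case: ifP => // t0; rewrite mulr_ge0 ?expR_ge0// invr_ge0 exprn_ge0// ltW.
Qed.

Lemma flatS k t : flat k t = flat k.+1 t * t.
Proof.
rewrite /flat; case: ifP => [t0|_]; last by rewrite mul0r.
by rewrite exprS invfM -[in RHS]mulrA mulrCA mulrAC mulVf ?mul1r ?gt_eqF// mulrC.
Qed.

Lemma flat_le k t : flat k t <= k.+1`!%:R * `|t|.
Proof.
rewrite flatS; rewrite {1}/flat; case: ifPn => [t0|]; last first.
  by rewrite mul0r mulr_ge0.
rewrite (gtr0_norm t0) ler_pM2r//.
have := @expR_ge1Dxn R t^-1 k; rewrite invr_ge0 (ltW t0) => /(_ isT) H.
have : t^-1 ^+ k.+1 / k.+1`!%:R <= expR t^-1 by apply: le_trans H; rewrite lerDr.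
rewrite ler_pdivrMr ?ltr0n ?fact_gt0// => H1.
by rewrite expRN ler_pdivrMr ?expR_gt0// mulrC -exprVn mulrC mulrC.
Qed.

Lemma flat_continuous0 k : {for 0, continuous (flat k)}.
Proof.
have f0 : flat k 0 = 0 by rewrite /flat ltxx.
rewrite /prop_for /continuous_at f0.
apply: (@squeeze_cvgr _ _ _ _ (cst 0) (fun t => k.+1`!%:R * `|t|)).
- by near=> t; rewrite /= flat_ge0 flat_le.
- exact: cvg_cst.
- rewrite -[X in _ --> X](mulr0 (k.+1`!%:R)); apply: cvgM; first exact: cvg_cst.
  have := @norm_continuous R R 0; rewrite /continuous_at normr0; exact.
Unshelve. all: by end_near. Qed.

Lemma flat_is_derive k (x : R) :
  is_derive x 1 (flat k) (flat k.+2 x + (- k%:R) * flat k.+1 x).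
Proof.
have [x0|x0|->] := ltgtP x 0.
- have -> : flat k.+2 x + - k%:R * flat k.+1 x = 0.
    by rewrite /flat ltNge (ltW x0) /= mulr0 addr0.
  apply: (@near_eq_is_derive _ _ _ (cst 0)) => //.
  near=> y; rewrite /flat ltNge; suff /ltW -> : y < 0 by [].
  by near: y; exact: lt_nbhsl.
- apply: (@near_eq_is_derive _ _ _ (fun t : R => t^-1 ^+ k * expR (- t^-1))) => //.
    near=> y; rewrite /flat; suff -> : 0 < y by rewrite -exprVn.
    by near: y; exact: lt_nbhsr.
  rewrite /flat x0.
  have h1 : is_derive x 1 (fun t : R => t^-1) (- x ^- 2).
    apply: is_derive_eq.
      apply: is_deriveV; first by rewrite gt_eqF.
    by rewrite /GRing.scale/= mulr1.
  have h2 : is_derive x 1 (fun t : R => expR (- t^-1)) (expR (- x^-1) * (x ^- 2)).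
    apply: (is_derive1_comp (f := expR) (g := fun t : R => - t^-1)) => //.
    by apply: is_derive_eq; rewrite opprK.
  have h3 : is_derive x 1 (fun t : R => t^-1 ^+ k) (k%:R * x^-1 ^+ k.-1 * (- x ^- 2)).
    have := @is_deriveX R R (fun t : R => t^-1) k x 1 _ h1.
    by rewrite exprfctE.
  have := @is_deriveM R R _ _ x 1 _ _ h3 h2.
  set b := (X in is_derive _ _ _ X); set c := (X in _ -> is_derive _ _ _ X).
  suff -> : b = c by [].
  rewrite /b /c /GRing.scale/=.
  case: k {h3 b c} => [|k].
    by rewrite !exprS !expr0 !mulr0n; ring.
  by rewrite /= -!exprVn !exprS; ring.
(* By [flatS] the slope function of [flat k] at 0 is [flat k.+1], which is continuous there with
   value 0. *)
- apply/is_derive1_caratheodory; exists (flat k.+1); split.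
  + by move=> z; rewrite subr0 -flatS [X in _ - X]/flat ltxx subr0.
  + exact: flat_continuous0.
  + by rewrite /flat ltxx mulr0 addr0.
Unshelve. all: by end_near. Qed.

Lemma smooth1_flat k : smooth1 (flat k).
Proof.
move=> m; elim: m k => [|m IH] k.
  exact: is_derive_continuous (flat_is_derive k).
exists (fun x => flat k.+2 x + (- k%:R) * flat k.+1 x); first exact: flat_is_derive.
by apply: CnD => //; apply: CnM => //; exact: Cn_cst.
Qed.


Lemma flat0_le1 t : flat 0 t <= 1.
Proof.
rewrite /flat; case: ifP => [t0|_]; last exact: ler01.
by rewrite expr0 invr1 mul1r expR_le1 oppr_le0 invr_ge0 ltW.
Qed.

Lemma flat0_le0 k t : t <= 0 -> flat k t = 0.
Proof. by rewrite /flat ltNge => ->. Qed.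

Lemma cvg_flat0 t : 0 < t -> flat 0 (m.+1%:R * t) @[m --> \oo] --> (1 : R).
Proof.
move=> t0.
have H m : flat 0 (m.+1%:R * t) = expR (- (harmonic m * t^-1)).
  by rewrite /flat mulr_gt0 ?ltr0n// expr0 invr1 mul1r invfM.
under eq_fun do rewrite H.
suff : expR (- (harmonic m * t^-1)) @[m --> \oo] --> expR (0 : R) by rewrite expR0.
apply: continuous_cvg; first exact: continuous_expR.
rewrite -oppr0 -(mul0r t^-1); apply: cvgN; apply: cvgM; last exact: cvg_cst.
exact: cvg_harmonic.
Qed.

(** Explicit smooth functions with values in the unit interval that vanish outside []a, b[] and
    converge pointwise to its indicator. Dominated convergence along them replaces mollification. *)
Definition cutoff (a b : R) (m : nat) (x : R) : R :=
  flat 0 (m.+1%:R * (x - a)) * flat 0 (m.+1%:R * (b - x)).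

Lemma cutoff_ge0 a b m x : 0 <= cutoff a b m x.
Proof. by rewrite mulr_ge0// flat_ge0. Qed.

Lemma cutoff_le1 a b m x : cutoff a b m x <= 1.
Proof. by rewrite -[leRHS]mulr1 ler_pM ?flat_ge0 ?flat0_le1. Qed.

Lemma cutoff_out a b m x : x <= a \/ b <= x -> cutoff a b m x = 0.
Proof.
rewrite /cutoff => -[xa|bx].
  by rewrite flat0_le0 ?mul0r// mulr_ge0_le0// subr_le0.
by rewrite [X in _ * X]flat0_le0 ?mulr0// mulr_ge0_le0// subr_le0.
Qed.

Lemma cvg_cutoff a b x :
  cutoff a b m x @[m --> \oo] --> (\1_`]a, b[ x : R).
Proof.
rewrite indicE; have [ax|ax] := ltP a x; last first.
  rewrite memNset/=; last by rewrite in_itv/= ltNge ax.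
  rewrite (_ : cutoff a b ^~ x = cst 0); first exact: cvg_cst.
  by apply/funext => m; rewrite cutoff_out//; left.
have [xb|xb] := ltP x b; last first.
  rewrite memNset/=; last by rewrite in_itv/= andbC ltNge xb.
  rewrite (_ : cutoff a b ^~ x = cst 0); first exact: cvg_cst.
  by apply/funext => m; rewrite cutoff_out//; right.
rewrite mem_set/=; last by rewrite in_itv/= ax xb.
suff : flat 0 (m.+1%:R * (x - a)) * flat 0 (m.+1%:R * (b - x)) @[m --> \oo]
    --> (1 * 1 : R) by rewrite mulr1.
by apply: cvgM; apply: cvg_flat0; rewrite subr_gt0.
Qed.

Lemma smooth1_cutoff a b m : smooth1 (cutoff a b m).
Proof.
move=> k; apply: CnM.
  have -> : (fun x => flat 0 (m.+1%:R * (x - a))) =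
      (fun x => flat 0 (m.+1%:R * x + - (m.+1%:R * a))).
    by apply/funext => x; rewrite mulrBr.
  exact/Cn_comp_affine/smooth1_flat.
have -> : (fun x => flat 0 (m.+1%:R * (b - x))) =
    (fun x => flat 0 ((- m.+1%:R) * x + m.+1%:R * b)).
  by apply/funext => x; rewrite mulrBr mulNr addrC.
exact/Cn_comp_affine/smooth1_flat.
Qed.

(** Integrating from minus infinity avoids any case distinction on the position of [x]: a cutoff is
    dominated by the indicator of [[a, b]], hence integrable on half-lines, and it is continuous. *)
Lemma cutoff_primitive a b m : exists F : R -> R,
  forall x : R, is_derive x 1 F (cutoff a b m x).
Proof.
pose mu := @lebesgue_measure R.
exists (fun x => \int[mu]_(t in [set` `]-oo, x]]) cutoff a b m t) => x.
have cf := smooth1_continuous (smooth1_cutoff a b m).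
have intf : mu.-integrable [set` `]-oo, (x + 1)]] (EFin \o cutoff a b m).
  have mD : measurable ([set` `]-oo, (x + 1)]] : set (measurableTypeR R)) by [].
  have := integrableS (@measurableT _ (measurableTypeR R)) mD (@subsetT _ _)
    (integrable_indic_itv a b true false).
  apply: le_integrable => //.
    apply/measurable_EFinP; apply: measurable_funTS.
    exact: continuous_measurable_fun.
  move=> t _ /=; rewrite lee_fin ger0_norm ?cutoff_ge0// indicE.
  case: (boolP (t \in _)) => [|/negP] H; first by rewrite normr1 cutoff_le1.
  rewrite normr0 le_eqVlt cutoff_out ?eqxx//.
  have [ta|ta] := leP t a; first by left.
  have [tb|tb] := leP b t; first by right.
  by exfalso; apply: H; rewrite inE/= in_itv/= !ltW.
have [|//|d1 d2] := continuous_FTC1 _ intf _ (cf x); first by rewrite ltrDl.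
  exact: ltNyr.
apply: (DeriveDef d1).
by rewrite -derive1E.
Qed.

(** The two bumps of the derivative are translates of each other by [h], so the difference of a
    primitive [F] and its translate works. By the mean value theorem it equals [h] times a value of
    the cutoff on [[x - h, x]], which gives both the range and the support. *)
Lemma tent a h m : 0 < h -> exists T : R -> R,
  [/\ smooth1 T,
      forall x : R, is_derive x 1 T (cutoff a (a + h) m x - cutoff (a + h) (a + h + h) m x),
      forall x, 0 <= T x <= h &
      forall x, x <= a \/ a + h + h <= x -> T x = 0].
Proof.
move=> h0; have [F dF] := cutoff_primitive a (a + h) m.
have cF := is_derive_continuous dF.
have mvt x : exists2 c, c \in `[x - h, x]%R & F x - F (x - h) = cutoff a (a + h) m c * h.
  have [||c cx ->] := @MVT_segment _ F (cutoff a (a + h) m) (x - h) x.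
  - by rewrite gerBl ltW.
  - exact: continuous_subspaceT.
  by exists c => //; rewrite subKr.
have sF : smooth1 F by apply/(smooth1_derive dF)/smooth1_cutoff.
exists (fun x => F x - F (x - h)); split.
- move=> k; apply: CnD; first exact: sF.
  have -> : (fun x => - F (x - h)) = (fun x => -1 * F (1 * x + - h)).
    by apply/funext => x; rewrite mul1r mulN1r.
  by apply: CnM; [exact: Cn_cst|exact: Cn_comp_affine].
- move=> x; have -> : cutoff (a + h) (a + h + h) m x = cutoff a (a + h) m (x - h).
    by rewrite /cutoff; congr (flat 0 (_ * _) * flat 0 (_ * _)); ring.
  apply: is_deriveB.
  have h1 : is_derive x 1 (fun x => x - h) 1.
    by apply: is_derive_eq; rewrite subr0.
  have := dF (x - h) => h2.
  rewrite -[cutoff _ _ _ _]mulr1.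
  exact: (is_derive1_comp (f := F) (g := fun x => x - h)).
- move=> x; have [c _ ->] := mvt x.
  by rewrite mulr_ge0 ?cutoff_ge0 ?(ltW h0)//= ler_piMl ?cutoff_le1// ltW.
- move=> x xo; have [c + ->] := mvt x; rewrite in_itv/= => /andP[c1 c2].
  rewrite cutoff_out ?mul0r//.
  case: xo => [xa|xa]; [left; exact: le_trans xa|right].
  by apply: le_trans c1; rewrite lerBrDr.
Qed.

End smooth_line.

(** * Smooth functions of product form on R^n *)

Section product_functions.
Variables (R : realType) (n : nat).
Local Notation Rn := 'rV[R]_n.
Implicit Types (w : 'I_n -> R -> R) (x : Rn) (i : 'I_n).

Definition prodf w x : R := \prod_(l < n) w l (x ord0 l).

Definition upd (T : Type) (w : 'I_n -> T) i (f : T) : 'I_n -> T :=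
  fun l => if l == i then f else w l.

Lemma prodf_upd w i f x :
  prodf (upd w i f) x = f (x ord0 i) * \prod_(l < n | l != i) w l (x ord0 l).
Proof.
rewrite /prodf (bigD1 i)//= /upd eqxx; congr (_ * _).
by apply: eq_bigr => l /negbTE ->.
Qed.

Lemma prodfD1 w i x :
  prodf w x = w i (x ord0 i) * \prod_(l < n | l != i) w l (x ord0 l).
Proof. by rewrite /prodf (bigD1 i). Qed.

Lemma prodf_is_derive w i f' x : is_derive (x ord0 i) 1 (w i) (f' (x ord0 i)) ->
  is_derive x (delta_mx ord0 i) (prodf w) (prodf (upd w i f') x).
Proof.
move=> [d e]; pose c := \prod_(l < n | l != i) w l (x ord0 l).
have E h : prodf w (h *: delta_mx ord0 i + x) = c * w i (h *: 1 + x ord0 i).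
  rewrite (prodfD1 w i) mulrC /c !mxE !eqxx/=; congr (_ * _).
  apply: eq_bigr => l li; rewrite !mxE eqxx/= (negbTE li).
  by rewrite mulr0 add0r.
have H : h^-1 *: (prodf w (h *: delta_mx ord0 i + x) - prodf w x) @[h --> 0^']
    --> c * f' (x ord0 i).
  have -> : (fun h => h^-1 *: (prodf w (h *: delta_mx ord0 i + x) - prodf w x)) =
      (fun h => c * (h^-1 *: (w i (h *: 1 + x ord0 i) - w i (x ord0 i)))).
    apply/funext => h; rewrite E (prodfD1 w i) -/c /GRing.scale/=; ring.
  apply: cvgM; first exact: cvg_cst.
  by rewrite -e; exact: d.
apply: DeriveDef; first by apply/cvg_ex; eexists; exact: H.
by rewrite prodf_upd mulrC -/c; apply: cvg_lim => //; exact: H.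
Qed.

Lemma prodf_continuous w : (forall l, continuous (w l)) -> continuous (prodf w).
Proof.
move=> cw.
have := @continuous_big R _ *%R 1 xpredT (@mul_continuous _) _ (index_enum 'I_n)
  (fun (l : 'I_n) (y : Rn) => w l (y ord0 l)); apply => l _ y.
apply: (@continuous_comp _ _ _ (fun y : Rn => y ord0 l)).
  exact: coord_continuous.
exact: cw.
Qed.

(** A partial derivative of a product of one-variable factors is again such a product, with one
    factor replaced by its derivative; iterated partials therefore never leave the family. *)
Lemma prodf_smooth w : (forall l, smooth1 (w l)) -> smooth (prodf w).
Proof.
have D v i : (forall l, smooth1 (v l)) -> exists2 v' : R -> R, smooth1 v' &
    forall x, is_derive x (delta_mx ord0 i) (prodf v) (prodf (upd v i v') x).
  move=> sv; have [v' dv _] := sv i 1%N; exists v'.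
    exact/(smooth1_derive dv).
  by move=> x; exact: prodf_is_derive.
move=> sw s; suff [v sv ->] : exists2 v, (forall l, smooth1 (v l)) &
    foldr (@partial R n) (prodf w) s = prodf v.
  split; first by apply: prodf_continuous => l; exact/smooth1_continuous.
  by move=> i x; have [v' _ /(_ x)[]] := D v i sv.
elim: s => [|i s [v sv /= ->]]; first by exists w.
have [v' sv' dv'] := D v i sv; exists (upd v i v').
  by move=> l; rewrite /upd; case: ifP.
by apply/funext => x; rewrite /partial; have [_] := dv' x.
Qed.

End product_functions.

(** * Lebesgue measure of boxes *)

Section lebesgue_boxes.
Variables (R : realType) (n : nat).
Local Notation Rn := 'rV[R]_n.
Local Notation mR := (measurableTypeR R).
Local Notation mu := (@lebesgue_Rn R n).
Implicit Types (E : set Rn).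

(** [measurable] on ['rV[R]_n] is Lebesgue measurability. This smaller class consists of the sets on
    which [mu] is literally the product measure, and it has convenient generators. *)
Definition borel E := measurable (@row_of_tuple R n @^-1` E).

(** The outer measure on rows is the one on tuples read through [row_of_tuple], so the Caratheodory
    condition for [E] is that for its preimage, tested on preimages only. *)
Lemma borel_measurable E : borel E -> measurable E.
Proof.
move=> bE; suff : caratheodory_measurable (@lebesgue_outer R n) E by [].
have : ((tuple_measure R n)^*)%mu.-cara.-measurable (@row_of_tuple R n @^-1` E).
  by apply: sub_caratheodory; exact: sub_sigma_algebra.
by move=> h X; exact: h (@row_of_tuple R n @^-1` X).
Qed.

Lemma lebesgue_Rn_borel E : borel E ->
  mu E = tuple_measure R n (@row_of_tuple R n @^-1` E).
Proof. by move=> bE; exact: measurable_mu_extE. Qed.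

Lemma borel_coord (i : 'I_n) (Y : set mR) : measurable Y -> borel [set x | Y (x ord0 i)].
Proof.
move=> mY; rewrite /borel (_ : _ @^-1` _ = (fun t : n.-tuple mR => tnth t i) @^-1` Y).
  by rewrite -[X in measurable X]setTI; exact: (measurable_tnth i).
by apply/seteqP; split => t /=; rewrite !mxE.
Qed.

Lemma borel_bigcap (I : finType) (F : I -> set Rn) :
  (forall j, borel (F j)) -> borel [set x | forall j, F j x].
Proof.
move=> bF; rewrite /borel.
rewrite (_ : _ @^-1` _ = \bigcap_(j in [set: I]) (@row_of_tuple R n @^-1` F j)).
  by apply: fin_bigcap_measurable => // j _; exact: bF.
by apply/seteqP; split => t /= h; [move=> j _; exact: h|move=> j; exact: h].
Qed.

Lemma tuple_measure_rectangle (A : 'I_n -> set mR) :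
  (forall i, measurable (A i)) ->
  tuple_measure R n [set t | forall i, A i (tnth t i)] =
  (\prod_(i < n) lebesgue_measure (A i))%E.
Proof.
elim: n A => [|m IH] A mA.
  by rewrite big_ord0 /= /tuple0_measure diracE mem_set// => -[].
rewrite big_ord_recl -IH//.
have -> : tuple_measure R m.+1 [set t | forall i, A i (tnth t i)] =
   (@lebesgue_measure R \x tuple_measure R m)%E
     (A ord0 `*` [set t | forall i, A (lift ord0 i) (tnth t i)]).
  rewrite /= /tupleS_measure /pushforward; congr (_ _).
  apply/seteqP; split => -[x t] /=.
    move=> h; split; first by have := h ord0; rewrite tnth0.
    by move=> i; have := h (lift ord0 i); rewrite tnthS.
  move=> [h0 h] i; have [j ->|->] := unliftP ord0 i; last by rewrite tnth0.
  by rewrite tnthS.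
rewrite product_measure1E//.
rewrite (_ : [set _ | _] = \bigcap_(i in [set: 'I_m]) ((fun t : m.-tuple mR => tnth t i)
    @^-1` A (lift ord0 i))).
  apply: fin_bigcap_measurable => // i _.
  by rewrite -[X in measurable X]setTI; exact: (measurable_tnth i).
by apply/seteqP; split => t /= h; [move=> j _; exact: h|move=> j; exact: h].
Qed.

Lemma lebesgue_Rn_rectangle (A : 'I_n -> set mR) :
  (forall i, measurable (A i)) ->
  mu [set x | forall i, A i (x ord0 i)] = (\prod_(i < n) lebesgue_measure (A i))%E.
Proof.
move=> mA; rewrite lebesgue_Rn_borel.
  rewrite -tuple_measure_rectangle//; congr (_ _).
  by apply/seteqP; split => t /= h i; have := h i; rewrite mxE.
by apply: borel_bigcap => i; exact: borel_coord.
Qed.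

(** Half-lines [[q, +oo[] generate the Borel sets of the line and coordinates generate the product
    sigma-algebra, so half-spaces suffice. This is the induction principle behind the dyadic
    approximation of sets. *)
Lemma borel_sigma_induction (G : set (set Rn)) : sigma_algebra setT G ->
  (forall (i : 'I_n) (q : R), G [set x | q <= x ord0 i]) -> forall E, borel E -> G E.
Proof.
move=> [G0 GC GU] Gh E bE.
pose tup (x : Rn) : n.-tuple mR := [tuple x ord0 i | i < n].
have tupK x : row_of_tuple (tup x) = x.
  by apply/rowP => i; rewrite mxE tnth_mktuple.
suff H : (measurable : set (set (n.-tuple mR))) `<=` [set T | G (tup @^-1` T)].
  rewrite (_ : E = tup @^-1` (@row_of_tuple R n @^-1` E)); first exact: (H _ bE).
  by apply/seteqP; split => x /=; rewrite tupK.
apply: smallest_sub.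
  split => /=; first by rewrite preimage_set0.
  - by move=> T GT; rewrite setTD preimage_setC -setTD; exact: GC.
  - by move=> F GF; rewrite preimage_bigcup; exact: GU.
move=> T; rewrite -bigcup_seq => -[i _] [Y mY <-] /=.
rewrite setTI (_ : _ @^-1` _ = [set x : Rn | Y (x ord0 i)]); last first.
  by apply/seteqP; split => x /=; rewrite tnth_mktuple.
move: Y mY; rewrite RGenCInfty.measurableE.
apply: smallest_sub => /=.
  split => /=; first exact: G0.
  - by move=> Y GY; exact: GC.
  - by move=> F GF; exact: GU.
move=> _ [q ->]; have := Gh i q; congr (G _).
by apply/seteqP; split => x /=; rewrite in_itv/= andbT.
Qed.


(** Half-open, so that the two halves of a box partition it exactly. The open variant [obox] is the
    one that limits of cutoffs produce. *)
Definition box (a l : 'I_n -> R) : set Rn :=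
  [set x | forall i, a i <= x ord0 i < a i + l i].

Definition obox (a l : 'I_n -> R) : set Rn :=
  [set x | forall i, a i < x ord0 i < a i + l i].

Lemma box_rectangle a l :
  box a l = [set x | forall i, `[a i, a i + l i[%classic (x ord0 i)].
Proof. by apply/seteqP; split => x /= h i; have := h i; rewrite in_itv. Qed.

Lemma obox_rectangle a l :
  obox a l = [set x | forall i, `]a i, a i + l i[%classic (x ord0 i)].
Proof. by apply/seteqP; split => x /= h i; have := h i; rewrite in_itv. Qed.

Lemma borel_box a l : borel (box a l).
Proof.
rewrite box_rectangle; apply: borel_bigcap => i.
exact: (@borel_coord i `[a i, a i + l i[%classic).
Qed.

Lemma borel_obox a l : borel (obox a l).
Proof.
rewrite obox_rectangle; apply: borel_bigcap => i.
exact: (@borel_coord i `]a i, a i + l i[%classic).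
Qed.

Lemma measurable_box a l : measurable (box a l).
Proof. by apply: borel_measurable; exact: borel_box. Qed.

Lemma measurable_obox a l : measurable (obox a l).
Proof. by apply: borel_measurable; exact: borel_obox. Qed.

Lemma lebesgue_Rn_box a l : (forall i, 0 < l i) ->
  mu (box a l) = (\prod_(i < n) l i)%:E.
Proof.
move=> l0; rewrite box_rectangle (@lebesgue_Rn_rectangle (fun i => `[a i,
    a i + l i[%classic))// -prodEFin.
apply: eq_bigr => i _; rewrite lebesgue_measure_itv/= lte_fin ltrDl l0.
by rewrite -EFinD addrAC subrr add0r.
Qed.

Lemma lebesgue_Rn_obox a l : (forall i, 0 < l i) ->
  mu (obox a l) = (\prod_(i < n) l i)%:E.
Proof.
move=> l0; rewrite obox_rectangle (@lebesgue_Rn_rectangle (fun i => `]a i,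
    a i + l i[%classic))// -prodEFin.
apply: eq_bigr => i _; rewrite lebesgue_measure_itv/= lte_fin ltrDl l0.
by rewrite -EFinD addrAC subrr add0r.
Qed.

Lemma obox_sub_box a l : obox a l `<=` box a l.
Proof. by move=> x h i; have /andP[h1 ->] := h i; rewrite ltW. Qed.

Lemma lebesgue_Rn_boxD a l : (forall i, 0 < l i) -> mu (box a l `\` obox a l) = 0%E.
Proof.
move=> l0; rewrite measureD//=.
- rewrite setIidr; last exact: obox_sub_box.
  by rewrite lebesgue_Rn_box// lebesgue_Rn_obox// subee.
- exact: measurable_box.
- exact: measurable_obox.
- by rewrite lebesgue_Rn_box// ltry.
Qed.

Lemma open_measurable_Rn (U : set Rn) : open U -> measurable U.
Proof.
move=> oU.
(* An open set is the union of the countably many cubes with rational centre [p.1] and half side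
   [p.2] that it contains. *)
pose C (p : 'rV[rat]_n * rat) := obox (fun i => ratr (p.1 ord0 i) - ratr p.2) (fun=> ratr
    p.2 *+ 2).
rewrite (_ : U = \bigcup_p (if `[< C p `<=` U >] then C p else set0)).
  apply: countable_bigcupT_measurable; first exact: countableP.
  by move=> p; case: ifP => // _; exact: measurable_obox.
apply/seteqP; split => [y Uy|y [p _]]; last by case: asboolP => // h /h.
have /nbhs_ballP[e /= e0 eU] : nbhs y U by exact: open_nbhs_nbhs.
have [r /itvP r0e] : exists r : rat, ratr r \in `]0, (e / 2)[.
  by apply: rat_in_itvoo; rewrite divr_gt0.
have r0 : 0 < ratr r :> R by rewrite r0e.
have /choice[q qP] : forall i : 'I_n, exists q : rat, ratr q \in `](y ord0 i - ratr r),
    (y ord0 i + ratr r)[.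
  by move=> i; apply: rat_in_itvoo; rewrite ltrD2l gtrN.
exists (\row_i q i, r) => //; rewrite asboolT /=.
  move=> i; rewrite /= mxE; have := qP i; rewrite in_itv/= => /andP[h1 h2].
  by apply/andP; split; lra.
move=> z Cz; apply: eU; split => // i j; rewrite (ord1 i) /ball/=.
have := Cz j; rewrite /= mxE; have := qP j; rewrite in_itv/= => /andP[h1 h2] /andP[h3 h4].
have r2 : ratr r < e / 2 by rewrite r0e.
by rewrite ltr_norml; apply/andP; split; lra.
Qed.

(** The infimum that defines the outer measure is attained up to [e] by a countable cover with
    measurable sets; the hull is the union of the cover. *)
Lemma borel_hull (E : set Rn) (e : R) : (mu E < +oo)%E -> 0 < e ->
  exists2 F, borel F & E `<=` F /\ (mu F <= mu E + e%:E)%E.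
Proof.
move=> Efin e0.
have Efn : mu E \is a fin_num.
  by rewrite ge0_fin_numE//; exact: outer_measure_ge0.
have [_ [F [mF EF] <-] muF] := lb_ereal_inf_adherent e0 Efn.
pose tup (x : Rn) : n.-tuple mR := [tuple x ord0 i | i < n].
have rowK (t : n.-tuple mR) : tup (row_of_tuple t) = t.
  by apply: eq_from_tnth => i; rewrite tnth_mktuple mxE.
have tupK x : row_of_tuple (tup x) = x.
  by apply/rowP => i; rewrite mxE tnth_mktuple.
have preF : (@row_of_tuple R n @^-1` (tup @^-1` \bigcup_k F k)) = \bigcup_k F k.
  by apply/seteqP; split => t /=; rewrite rowK.
have bF : borel (tup @^-1` \bigcup_k F k).
  by rewrite /borel preF; exact: bigcup_measurable.
exists (tup @^-1` \bigcup_k F k) => //; split.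
  by move=> x Ex; apply: EF; rewrite /= tupK.
rewrite lebesgue_Rn_borel// preF; apply: le_trans (ltW muF).
by apply: measure_sigma_subadditive => //; exact: bigcup_measurable.
Qed.

End lebesgue_boxes.

(** * Differences of averages over half boxes *)

Section weak_partial_boxes.
Variables (R : realType) (n : nat).
Local Notation Rn := 'rV[R]_n.
Local Notation mu := (@lebesgue_Rn R n).
Implicit Types (a l : 'I_n -> R) (i : 'I_n) (U G : Rn -> R).

Lemma continuous_measurable_Rn (f : Rn -> R) : continuous f -> measurable_fun setT f.
Proof.
move=> cf; apply: (measurability _ (RGenOInfty.measurableE R)) => //.
move=> _ [_ [x ->] <-]; rewrite setTI; apply: open_measurable_Rn.
by move/continuousP : cf; apply; exact: interval_open.
Qed.

Lemma integrable_mul_bounded U (w : Rn -> R) (c : R) :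
  mu.-integrable setT (EFin \o U) -> measurable_fun setT w ->
  (forall x, `|w x| <= c) -> mu.-integrable setT (EFin \o (fun x => U x * w x)).
Proof.
move=> iU mw wc.
have c0 : 0 <= c by apply: le_trans (wc 0).
have mU : measurable_fun setT U by apply/measurable_EFinP; exact: measurable_int iU.
have mUw : measurable_fun setT (EFin \o (fun x => U x * w x)).
  by apply/measurable_EFinP; exact: measurable_funM.
apply: (le_integrable measurableT mUw _ (integrableZl measurableT c iU)).
move=> x _; rewrite /= lee_fin normrM [leRHS]normrM mulrC.
by rewrite ler_wpM2r// (ger0_norm c0).
Qed.

Definition halve l i : 'I_n -> R := upd l i (l i / 2).
Definition midcorner a l i : 'I_n -> R := upd a i (a i + l i / 2).

Variables (a l : 'I_n -> R) (i : 'I_n).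
Hypothesis l0 : forall j, 0 < l j.
Let h := l i / 2.
Let h0 : 0 < h. Proof. by rewrite divr_gt0. Qed.

Let tm (m : nat) := projT1 (cid (tent (a i) m h0)).
Let tmP (m : nat) := projT2 (cid (tent (a i) m h0)).
Let w (m : nat) : 'I_n -> R -> R := upd (fun j => cutoff (a j) (a j + l j) m) i (tm m).

Let w_smooth (m : nat) j : smooth1 (w m j).
Proof.
rewrite /w /upd; case: ifP => _; last exact: smooth1_cutoff.
by have [] := tmP m.
Qed.

Let w_out (m : nat) j (x : R) : x <= a j \/ a j + l j <= x -> w m j x = 0.
Proof.
rewrite /w /upd; case: eqP => [->|_] H; last by rewrite cutoff_out.
have [_ _ _] := tmP m; apply.
by case: H => ?; [left|right]; rewrite // -addrA /h -splitr.
Qed.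

Let other (m : nat) (x : Rn) := \prod_(j < n | j != i) cutoff (a j) (a j +
    l j) m (x ord0 j).

Let other_itv (m : nat) x : 0 <= other m x <= 1.
Proof.
rewrite /other prodr_ge0 => [|j _]; last exact: cutoff_ge0.
by apply: prodr_ile1 => j _; rewrite cutoff_ge0 cutoff_le1.
Qed.

Let prodf_other (m : nat) f x :
  prodf (upd (w m) i f) x = f (x ord0 i) * other m x.
Proof.
rewrite prodf_upd; congr (_ * _); apply: eq_bigr => j ji.
by rewrite /w /upd (negbTE ji).
Qed.

Let dt (m : nat) (t : R) :=
  cutoff (a i) (a i + h) m t - cutoff (a i + h) (a i + h + h) m t.

Let dt_le1 m t : `|dt m t| <= 1.
Proof.
rewrite /dt ler_norml; apply/andP; split.
  by rewrite lerBrDr (le_trans _ (cutoff_ge0 _ _ _ _))// addrC subr_le0 cutoff_le1.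
by rewrite lerBlDr (le_trans (cutoff_le1 _ _ _ _))// lerDl cutoff_ge0.
Qed.

(** In direction [i] the tent rises with limiting slope 1 over the lower half and falls with
    limiting slope -1 over the upper half, while the other factors tend to indicators. The height
    [h] of the tent becomes the constant of the half-box inequality. *)
Lemma half_box_test_functions : exists psi : nat -> Rn -> R,
  [/\ forall m, smooth (psi m),
     forall m x, `|psi m x| <= h * \1_(obox a l) x,
     forall m x, `|partial i (psi m) x| <= 1 &
     forall x, partial i (psi m) x @[m --> \oo] -->
       (\1_(obox a (halve l i)) x - \1_(obox (midcorner a l i) (halve l i)) x : R)].
Proof.
exists (fun m => prodf (w m)).
have dpsi m x : partial i (prodf (w m)) x = dt m (x ord0 i) * other m x.
  rewrite -prodf_other; have [_ dT _ _] := tmP m.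
  have : is_derive (x ord0 i) 1 (w m i) (dt m (x ord0 i)).
    by rewrite /w /upd eqxx; exact: dT.
  by move=> /(@prodf_is_derive _ _ (w m) i (dt m) x)[].
split.
- by move=> m; exact: prodf_smooth.
- move=> m x; have [xb|/existsNP[j /negP]] := pselect (obox a l x); last first.
    rewrite negb_and -!leNgt => H.
    rewrite (prodfD1 _ j) (_ : w m j _ = 0).
      by rewrite mul0r normr0 mulr_ge0 ?(ltW h0)// indicE.
    by apply: w_out; case/orP: H; [left|right].
  rewrite indicE mem_set// mulr1.
  have -> : w m = upd (w m) i (tm m).
    by apply/funext => j; rewrite /w /upd; case: (j == i).
  have [_ _ /(_ (x ord0 i))/andP[p1 p2] _] := tmP m.
  have /andP[u1 u2] := other_itv m x.
  by rewrite prodf_other normrM !ger0_norm// -[leRHS]mulr1 ler_pM.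
- move=> m x; rewrite dpsi normrM -[leRHS]mulr1 ler_pM//.
  by have /andP[u1 u2] := other_itv m x; rewrite ger0_norm.
- move=> x; under eq_fun do rewrite dpsi.
  pose A := fun j => `]a j, a j + l j[%classic : set R.
  (* Both half boxes have the sides of [box a l] in the directions other than [i], so one
     factorization of the indicator serves for the two of them. *)
  have E (b c : 'I_n -> R) : (forall j, j != i -> b j = a j /\ c j = l j) ->
      \1_(obox b c) x = \1_`]b i, b i + c i[ (x ord0 i) *
        \prod_(j < n | j != i) \1_(A j) (x ord0 j) :> R.
    move=> bc; have [xb|/existsNP[j /negP xb]] := pselect (obox b c x).
      rewrite indicE mem_set// indicE mem_set/=; last by rewrite in_itv/=; exact: xb.
      rewrite big1 ?mulr1// => j ji; rewrite indicE mem_set// /A /= in_itv/=.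
      by have := xb j; have [-> ->] := bc _ ji.
    rewrite indicE memNset; last by move=> /(_ j); exact/negP.
    have [ji|ji] := eqVneq j i.
      by rewrite indicE memNset ?mul0r//= in_itv/= -ji; exact/negP.
    have Aj : \1_(A j) (x ord0 j) = 0 :> R.
      rewrite indicE memNset// /A /= in_itv/=.
      by have [<- <-] := bc _ ji; exact/negP.
    by rewrite (bigD1 j)//= Aj mul0r mulr0.
  have Ea : midcorner a l i i = a i + h by rewrite /midcorner /upd eqxx.
  have El : halve l i i = h by rewrite /halve /upd eqxx.
  rewrite E; last by move=> j ji; rewrite /halve /upd (negbTE ji).
  rewrite E; last by move=> j ji; rewrite /halve /midcorner /upd (negbTE ji).
  rewrite Ea El -mulrBl; apply: cvgM.
    by apply: cvgB; exact: cvg_cutoff.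
  have := @cvg_big R _ *%R 1 (fun j => j != i) (@mul_continuous _) _ _ (index_enum 'I_n)
    (fun j m => cutoff (a j) (a j + l j) m (x ord0 j)) (fun j => \1_(A j) (x ord0 j)).
  by apply => j _; exact: cvg_cutoff.
Qed.

Lemma Rintegral_mul_indic U (E : set Rn) :
  \int[mu]_(x in E) U x = \int[mu]_x (U x * \1_E x).
Proof. by rewrite Rintegral_mkcond patch_indic. Qed.

Lemma Rintegral_obox b c U : (forall j, 0 < c j) -> mu.-integrable setT (EFin \o U) ->
  \int[mu]_(x in obox b c) U x = \int[mu]_(x in box b c) U x.
Proof.
move=> c0 iU; have mB := @measurable_box R n b c; have mO := @measurable_obox R n b c.
have BE : box b c = obox b c `|` (box b c `\` obox b c).
  by rewrite setDUK//; exact: obox_sub_box.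
have mD := measurableD mB mO.
rewrite [in RHS]BE Rintegral_setU//; last 2 first.
- by rewrite -BE; exact: (integrableS measurableT mB (@subsetT _ _) iU).
- by apply/disj_setPS => x [? [_]].
have mUD : measurable_fun (box b c `\` obox b c) (EFin \o U).
  by apply: measurable_funTS; exact: measurable_int iU.
have N0 := null_set_integral mD mUD (lebesgue_Rn_boxD b c0).
by rewrite [X in _ = _ + X](_ : _ = 0) ?addr0// /Rintegral N0.
Qed.

(** Testing with [psi m] bounds the left side uniformly in [m], since [psi m] is at most [h] and
    lives on the box; the limit is taken by dominated convergence with majorant [|U|]. The closed
    box has to lie in [V] because it is the compact set that carries the test functions. Integrals
    over all of R^n correspond to functions extended by 0. *)
Lemma weak_partial_half_boxes (V : set Rn) U G :
  (forall x : Rn, (forall j, a j <= x ord0 j <= a j + l j) -> V x) ->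
  mu.-integrable setT (EFin \o U) -> mu.-integrable setT (EFin \o G) ->
  (forall psi, test_function V psi ->
    \int[mu]_x (U x * partial i psi x) = - \int[mu]_x (G x * psi x)) ->
  `|\int[mu]_(x in box (midcorner a l i) (halve l i)) U x - \int[mu]_(x in box a (halve l
      i)) U x|
    <= h * \int[mu]_(x in box a l) `|G x|.
Proof.
move=> aV iU iG UG; have [psi [spsi psile dle dcvg]] := half_box_test_functions.
have lo0 j : 0 < halve l i j by rewrite /halve /upd; case: ifP => _ //; rewrite divr_gt0.
have test m : test_function V (psi m).
  split; first exact: spsi.
  exists [set x | forall j, `[a j, a j + l j]%classic (x ord0 j)]; split.
  - apply: (@rV_compact _ _ (fun j => `[a j, a j + l j]%classic)) => j.
    exact: segment_compact.
  - by move=> x /= xa; apply: aV => j; have := xa j; rewrite in_itv.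
  - move=> x /= xa; apply/eqP; rewrite -normr_le0 (le_trans (psile m x))//.
    rewrite indicE memNset ?mulr0// => xo; apply: xa => j.
    by have /andP[u1 u2] := xo j; rewrite in_itv/= !ltW.
have mpsi m : measurable_fun setT (psi m).
  by apply: continuous_measurable_Rn; have [] := spsi m [::].
have mdpsi m : measurable_fun setT (partial i (psi m)).
  by apply: continuous_measurable_Rn; have [] := spsi m [:: i].
have bnd m : `|\int[mu]_x (U x * partial i (psi m) x)| <=
    h * \int[mu]_(x in box a l) `|G x|.
  have psih x : `|psi m x| <= h.
    by rewrite (le_trans (psile m x))// ler_piMr// ?(ltW h0)// indicE lern1 leq_b1.
  have iGp := integrable_mul_bounded iG (mpsi m) psih.
  have inG := integrable_norm iG.
  have mO := @measurable_obox R n a l.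
  rewrite UG// normrN (le_trans (le_normr_Rintegral _ iGp))//.
  rewrite -Rintegral_obox// -RintegralZl//; last first.
    exact: (integrableS measurableT mO (@subsetT _ _) inG).
  rewrite Rintegral_mul_indic; apply: le_Rintegral => //.
  - exact: integrable_norm.
  - apply: (@integrable_mul_bounded (fun x => h * `|G x|) _ 1).
    + exact: (integrableZl measurableT h inG).
    + by apply: measurable_indic.
    + by move=> x; rewrite indicE normr_nat lern1 leq_b1.
  - by move=> x _; rewrite normrM mulrAC [X in _ <= X]mulrC ler_wpM2l.
pose I1 : Rn -> R := \1_(obox a (halve l i)).
pose I2 : Rn -> R := \1_(obox (midcorner a l i) (halve l i)).
have mI1 : measurable_fun setT I1 by apply: measurable_indic; exact: measurable_obox.
have mI2 : measurable_fun setT I2 by apply: measurable_indic; exact: measurable_obox.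
have I1le x : `|I1 x| <= 1 by rewrite /I1 indicE normr_nat lern1 leq_b1.
have I2le x : `|I2 x| <= 1 by rewrite /I2 indicE normr_nat lern1 leq_b1.
have iU1 := integrable_mul_bounded iU mI1 I1le.
have iU2 := integrable_mul_bounded iU mI2 I2le.
have iU12 : mu.-integrable setT (EFin \o (fun x => U x * (I1 x - I2 x))).
  apply: (integrable_mul_bounded iU (measurable_funB mI1 mI2)).
  by move=> x; apply: (le_trans (ler_normB _ _)); apply: lerD.
have mU : measurable_fun setT U by apply/measurable_EFinP; exact: measurable_int iU.
have cv : \int[mu]_x (U x * partial i (psi m) x) @[m --> \oo] -->
    \int[mu]_x (U x * (I1 x - I2 x)).
  have mf (m : nat) : measurable_fun setT (fun x => (U x * partial i (psi m) x)%:E).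
    by apply/measurable_EFinP; exact: measurable_funM.
  have cf x : setT x -> (U x * partial i (psi m) x)%:E @[m --> \oo] -->
      (U x * (I1 x - I2 x))%:E.
    move=> _; apply/fine_cvgP; split; first exact: nearW.
    by apply: cvgM; [exact: cvg_cst|exact: dcvg].
  have df (m : nat) x : setT x -> (`|(U x * partial i (psi m) x)%:E| <= `|(U x)%:E|)%E.
    by move=> _; rewrite /= lee_fin normrM ler_piMr.
  have ff x : setT x -> `|(U x)%:E|%E \is a fin_num by [].
  apply: fine_cvg; rewrite fineK; last exact: (integrable_fin_num measurableT iU12).
  exact: (dominated_cvg measurableT mf cf ff (integrable_abse iU) df).
have E1 := Rintegral_obox a lo0 iU; have E2 := Rintegral_obox (midcorner a l i) lo0 iU.
have E3 : \int[mu]_x (U x * (I1 x - I2 x)) =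
    \int[mu]_(x in obox a (halve l i)) U x - \int[mu]_(x in obox (midcorner a l i) (halve
        l i)) U x.
  rewrite (Rintegral_mul_indic U (obox a (halve l i))).
  rewrite (Rintegral_mul_indic U (obox (midcorner a l i) (halve l i))).
  rewrite -(RintegralB measurableT iU1 iU2); apply: eq_Rintegral => x _.
  by rewrite mulrBr.
rewrite distrC -[X in `|X - _|]E1 -[X in `|_ - X|]E2 -E3.
apply: (cvgr_to_le (cvg_norm cv)).
by near=> m; exact: bnd.
Unshelve. all: by end_near. Qed.

End weak_partial_boxes.

(** * Successive halvings of a box *)

Section dyadic_boxes.
Variables (R : realType) (n : nat).
Local Notation Rn := 'rV[R]_n.
Local Notation mu := (@lebesgue_Rn R n).
Implicit Types (a l : 'I_n -> R) (S : set Rn) (s : seq 'I_n).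

Definition vol l : R := \prod_(j < n) l j.

Lemma vol_gt0 l : (forall j, 0 < l j) -> 0 < vol l.
Proof. by move=> l0; apply: prodr_gt0 => j _. Qed.

Lemma lo_gt0 l i : (forall j, 0 < l j) -> forall j, 0 < halve l i j.
Proof. by move=> l0 j; rewrite /halve /upd; case: ifP => _ //; rewrite divr_gt0. Qed.

Lemma vol_lo l i : vol (halve l i) = vol l / 2.
Proof.
rewrite /vol (bigD1 i)//= [in RHS](bigD1 i)//= {1}/halve /upd eqxx mulrAC.
by congr (_ * _ / _); apply: eq_bigr => j ji; rewrite /halve /upd (negbTE ji).
Qed.

Lemma box_halves a l i : (forall j, 0 < l j) ->
  box a l = box a (halve l i) `|` box (midcorner a l i) (halve l i).
Proof.
move=> l0; have h0 : 0 < l i / 2 by rewrite divr_gt0.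
apply/seteqP; split => x.
  move=> xB; have [xh|xh] := ltP (x ord0 i) (a i + l i / 2); [left|right] => j;
    have := xB j; rewrite /midcorner /halve /upd; case: eqP => [->|_] // /andP[x1 x2];
    apply/andP; split => //; lra.
by case=> xB j; have := xB j; rewrite /midcorner /halve /upd;
    case: eqP => [->|_] // /andP[x1 x2];
  apply/andP; split; lra.
Qed.

Lemma box_halves_disj a l i : box a (halve l i) `&` box (midcorner a l i) (halve l i) =
    set0.
Proof.
rewrite -subset0 => x [] /(_ i) + /(_ i); rewrite /midcorner /halve /upd eqxx.
by move=> /andP[_ x1] /andP[/(lt_le_trans x1)]; rewrite ltxx.
Qed.

Lemma sub_box_lo a l i : (forall j, 0 < l j) -> box a (halve l i) `<=` box a l.
Proof. by move=> l0; rewrite (box_halves a i l0); exact: subsetUl. Qed.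

Lemma sub_box_hi a l i : (forall j, 0 < l j) -> box (midcorner a l i) (halve l i) `<=`
    box a l.
Proof. by move=> l0; rewrite (box_halves a i l0); exact: subsetUr. Qed.

(* [S] is, inside [box a l], a union of cells of the partition obtained by
   halving successively in the directions listed in [s]. *)
Fixpoint dyadic_union s a l S : Prop :=
  if s is i :: s' then dyadic_union s' a (halve l i) S /\ dyadic_union s' (midcorner a l
      i) (halve l i) S
  else box a l `&` S = set0 \/ box a l `<=` S.

Lemma dyadic_union_trivial s a l S : (forall j, 0 < l j) ->
  box a l `&` S = set0 \/ box a l `<=` S -> dyadic_union s a l S.
Proof.
elim: s a l => [//|i s IH] a l l0 H /=; have l'0 := lo_gt0 i l0.
split; apply: IH => //; case: H => H; [left|right|left|right].
- by rewrite -subset0 -H; apply: setSI; exact: sub_box_lo.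
- by apply: subset_trans H; exact: sub_box_lo.
- by rewrite -subset0 -H; apply: setSI; exact: sub_box_hi.
- by apply: subset_trans H; exact: sub_box_hi.
Qed.

Lemma dyadic_union_cat s s' a l S : (forall j, 0 < l j) -> dyadic_union s a l S ->
    dyadic_union (s ++ s') a l S.
Proof.
elim: s a l => [|i s IH] a l l0 /=; first exact: dyadic_union_trivial.
by have l'0 := lo_gt0 i l0; move=> [H1 H2]; split; exact: IH.
Qed.

(** Only the part of [S] inside the box matters, which allows sets chosen separately on the two
    halves to be glued. *)
Lemma dyadic_union_ext s a l S S' : (forall j, 0 < l j) ->
  box a l `&` S = box a l `&` S' -> dyadic_union s a l S -> dyadic_union s a l S'.
Proof.
elim: s a l => [|i s IH] a l l0 SS' /=.
  rewrite -SS' => -[H|H]; [by left|right].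
  by rewrite -(setIidl H) SS'; exact: subIsetr.
have l'0 := lo_gt0 i l0.
move=> [H1 H2]; split; [apply: IH H1|apply: IH H2] => //.
  by rewrite -(setIidl (@sub_box_lo a l i l0)) -!setIA SS'.
by rewrite -(setIidl (@sub_box_hi a l i l0)) -!setIA SS'.
Qed.

Lemma dyadic_unionC s a l S : dyadic_union s a l S -> dyadic_union s a l (~` S).
Proof.
elim: s a l => [|i s IH] a l /=; last by move=> [H1 H2]; split; exact: IH.
by case=> [/disjoints_subset|/subsets_disjoint] H; [right|left].
Qed.

Lemma dyadic_unionU s a l S S' : dyadic_union s a l S -> dyadic_union s a l S' ->
    dyadic_union s a l (S `|` S').
Proof.
elim: s a l => [|i s IH] a l /=.
  case=> H [] H'.
  - by left; rewrite setIUr H H' setU0.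
  - by right; apply: subset_trans H' _; exact: subsetUr.
  - by right; apply: subset_trans H _; exact: subsetUl.
  - by right; apply: subset_trans H _; exact: subsetUl.
by move=> [H1 H2] [H1' H2']; split; exact: IH.
Qed.

Lemma dyadic_union_join i s a l S1 S2 : (forall j, 0 < l j) ->
  dyadic_union s a (halve l i) S1 -> dyadic_union s (midcorner a l i) (halve l i) S2 ->
  dyadic_union (i :: s) a l (box a (halve l i) `&` S1 `|` box (midcorner a l i) (halve l
      i) `&` S2).
Proof.
move=> l0 H1 H2; have l'0 := lo_gt0 i l0; split.
  apply: dyadic_union_ext H1 => //.
  by rewrite setIUr !setIA setIid box_halves_disj set0I setU0.
apply: dyadic_union_ext H2 => //.
by rewrite setIUr !setIA setIid (setIC _ (box a _)) box_halves_disj set0I set0U.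
Qed.

(* Only longest sides are halved, which preserves [balanced]. *)
Fixpoint splits_longest s l : Prop :=
  if s is i :: s' then (forall j, l j <= l i) /\ splits_longest s' (halve l i) else True.

Definition balanced l := forall i j, l i <= 2 * l j.

(** The only new constraint bounds the other sides by twice the halved one, that is by [l i], which
    was a longest side. *)
Lemma balanced_lo l i : (forall j, 0 < l j) -> (forall j, l j <= l i) ->
  balanced l -> balanced (halve l i).
Proof.
move=> l0 li bl j k; rewrite /halve /upd.
have := li j; have := bl j k; have := bl i k; have := l0 k; have := l0 i; have := l0 j.
by case: eqP => [->|_]; case: eqP => [->|_] => *; lra.
Qed.

Definition round_robin (k : nat) : seq 'I_n := flatten (nseq k (enum 'I_n)).

Lemma round_robinD k m : round_robin (k + m) = round_robin k ++ round_robin m.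
Proof. by rewrite /round_robin nseqD flatten_cat. Qed.

Lemma count_round_robin i k : count_mem i (round_robin k) = k.
Proof.
elim: k => [//|k IH]; rewrite /round_robin /= count_cat -/(round_robin k) IH.
by rewrite count_uniq_mem ?enum_uniq// mem_enum.
Qed.

Lemma splits_longest_round_robin k (L : R) : 0 < L ->
    splits_longest (round_robin k) (fun=> L).
Proof.
elim: k L => [//|k IH] L L0; rewrite /round_robin /= -/(round_robin k).
have L20 : 0 < L / 2 by rewrite divr_gt0.
(* Invariant within one round: [r] lists the directions still to be halved, whose sides are [L],
   while all other sides are already [L / 2]. The head of [r] is thus always a longest side. *)
suff H (r : seq 'I_n) : uniq r ->
    splits_longest (r ++ round_robin k) (fun j => if j \in r then L else L / 2).
  have := H _ (enum_uniq 'I_n); congr splits_longest.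
  by apply/funext => j; rewrite mem_enum.
elim: r => [_|i r IHr /= /andP[ir ur]]; first exact: IH.
split.
  move=> j; rewrite [X in _ <= X]ifT ?mem_head//.
  by case: ifP => _ //; lra.
have := IHr ur; congr splits_longest; apply/funext => j;
    rewrite /halve /upd mem_head in_cons.
by case: eqP => [->|//]; rewrite (negbTE ir).
Qed.

Definition sdiff (A B : set Rn) := (A `\` B) `|` (B `\` A).

Lemma measurable_sdiff A B : measurable A -> measurable B -> measurable (sdiff A B).
Proof. by move=> mA mB; apply: measurableU; exact: measurableD. Qed.

Lemma measurable_halfspace (i : 'I_n) (q : R) :
  measurable [set x : Rn | q <= x ord0 i].
Proof.
have -> : [set x : Rn | q <= x ord0 i] = [set x | `[q, +oo[%classic (x ord0 i)].
  by apply/seteqP; split => x /=; rewrite in_itv/= andbT.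
by apply: borel_measurable; apply: (@borel_coord _ _ i `[q, +oo[%classic).
Qed.

(** The error lives in the cells crossed by the hyperplane. A halving in direction [i] leaves at
    most one of the two halves crossed, so the bound is halved; a halving in another direction only
    splits the error. *)
Lemma halfspace_dyadic_union (i : 'I_n) (q : R) s a l : (forall j, 0 < l j) ->
  exists S, [/\ measurable S, dyadic_union s a l S &
    (mu (box a l `&` sdiff [set x : Rn | (q <= x ord0 i)%R] S) <=
      (vol l / 2 ^+ count_mem i s)%:E)%E].
Proof.
set H := [set x | _].
have mH : measurable H by exact: measurable_halfspace.
elim: s a l => [|j s IH] a l l0.
  exists set0; split => //; first by left; rewrite setI0.
  rewrite /= expr0 divr1 -(lebesgue_Rn_box a)//; apply: le_measure.
  + rewrite inE; apply: measurableI; first exact: measurable_box.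
    exact: measurable_sdiff.
  + by rewrite inE; exact: measurable_box.
  + exact: subIsetl.
have l'0 := lo_gt0 j l0.
have mlo := @measurable_box R n a (halve l j).
have mhi := @measurable_box R n (midcorner a l j) (halve l j).
(* The error of a glued set is at most the sum of the errors on the two halves. *)
have join S1 S2 : measurable S1 -> measurable S2 ->
    (mu (box a l `&` sdiff H (box a (halve l j) `&` S1 `|` box (midcorner a l j) (halve l
        j) `&` S2))
    <= mu (box a (halve l j) `&` sdiff H S1) + mu (box (midcorner a l j) (halve l j) `&`
        sdiff H S2))%E.
  move=> mS1 mS2.
  apply: (le_trans _ (measureU2 _ _ _)); last 2 first.
  - by apply: measurableI => //; exact: measurable_sdiff.
  - by apply: measurableI => //; exact: measurable_sdiff.
  apply: le_measure; rewrite ?inE.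
  - apply: measurableI; first exact: measurable_box.
    by apply: measurable_sdiff => //; apply: measurableU; exact: measurableI.
  - by apply: measurableU; apply: measurableI => //; exact: measurable_sdiff.
  rewrite {1}(box_halves a j l0) => x [[] Bx D]; [left|right]; split=> //.
  - case: D => [[Hx D]|[[[_ ?]|[Bx' _]] nH]]; [left|right|exfalso].
    + by split=> // S1x; apply: D; left.
    + by [].
    + by have : set0 x by rewrite -(box_halves_disj a l j).
  - case: D => [[Hx D]|[[[Bx' _]|[_ ?]] nH]]; [left|exfalso|right].
    + by split=> // S1x; apply: D; right.
    + by have : set0 x by rewrite -(box_halves_disj a l j).
    + by [].
have [S1 [mS1 tS1 e1]] := IH a _ l'0.
have [S2 [mS2 tS2 e2]] := IH (midcorner a l j) _ l'0.
rewrite /= ; have [ji|ji] := eqVneq j i; last first.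
  exists (box a (halve l j) `&` S1 `|` box (midcorner a l j) (halve l j) `&` S2); split.
  - by apply: measurableU; exact: measurableI.
  - exact: dyadic_union_join.
  - apply: (le_trans (join _ _ mS1 mS2)); apply: (le_trans (leeD e1 e2)).
    by rewrite -EFinD lee_fin vol_lo add0n -mulrDl -splitr.
(* If the threshold is at most the midpoint, the upper half lies in the half-space and is taken
   whole; otherwise the lower half misses it and is left out. Either way one half contributes no
   error. *)
have [qm|qm] := leP q (a j + l j / 2).
- exists (box a (halve l j) `&` S1 `|` box (midcorner a l j) (halve l j) `&` setT); split.
  - by apply: measurableU; exact: measurableI.
  - by apply: dyadic_union_join => //; apply: dyadic_union_trivial => //; right.
  - apply: (le_trans (join _ _ mS1 measurableT)).
    rewrite [X in (_ + X)%E](_ : _ = 0%E) ?adde0.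
      by rewrite (le_trans e1)// vol_lo exprS invfM mulrA.
    rewrite (_ : _ `&` _ = set0) ?measure0// -subset0 => x [xB [[_ []//]|[_ nH]]].
    apply: nH; rewrite /H /= -ji (le_trans qm)//.
    by have := xB j; rewrite /midcorner /upd eqxx => /andP[].
- exists (box a (halve l j) `&` set0 `|` box (midcorner a l j) (halve l j) `&` S2); split.
  - by apply: measurableU; exact: measurableI.
  - by apply: dyadic_union_join => //; apply: dyadic_union_trivial => //; left;
      rewrite setI0.
  - apply: (le_trans (join _ _ measurable0 mS2)).
    rewrite [X in (X + _)%E](_ : _ = 0%E) ?add0e.
      by rewrite (le_trans e2)// vol_lo exprS invfM mulrA.
    rewrite (_ : _ `&` _ = set0) ?measure0// -subset0 => x [xB [[xH _]|[//]]].
    have := xB j; rewrite /halve /upd eqxx => /andP[_]; rewrite ltNge => /negP; apply.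
    by move: xH; rewrite /H /= -ji; apply: le_trans; exact: ltW.
Qed.

End dyadic_boxes.

(** * Density of dyadic unions among the measurable subsets of a cube *)

Section dyadic_approximation.
Variables (R : realType) (n : nat).
Local Notation Rn := 'rV[R]_n.
Local Notation mu := (@lebesgue_Rn R n).
Variables (a0 : 'I_n -> R) (L : R).
Hypothesis L0 : 0 < L.
Let l0 : 'I_n -> R := fun=> L.
Let l0_gt0 (j : 'I_n) : 0 < l0 j. Proof. exact: L0. Qed.
Local Notation B0 := (box a0 l0).
Let mB0 : measurable B0. Proof. exact: measurable_box. Qed.
Let B0fin : (mu B0 < +oo)%E. Proof. by rewrite lebesgue_Rn_box// ltry. Qed.

Let mu_ge0 (A : set Rn) : (0 <= mu A)%E. Proof. exact: outer_measure_ge0. Qed.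

Definition approximable (A : set Rn) := forall e : R, 0 < e -> exists k S,
  [/\ measurable S, dyadic_union (round_robin n k) a0 l0 S &
      (mu (B0 `&` sdiff A S) <= e%:E)%E].

Let dyadic_union_le k m S : (k <= m)%N -> dyadic_union (round_robin n k) a0 l0 S ->
    dyadic_union (round_robin n m) a0 l0 S.
Proof. by move=> /subnKC <- H; rewrite round_robinD; exact: dyadic_union_cat. Qed.

Let mBD A S : measurable A -> measurable S -> measurable (B0 `&` sdiff A S).
Proof. by move=> mA mS; apply: measurableI => //; exact: measurable_sdiff. Qed.

Lemma approximableC A : approximable A -> approximable (~` A).
Proof.
move=> HA e e0; have [k [S [mS tS muS]]] := HA e e0; exists k, (~` S); split.
- exact: measurableC.
- exact: dyadic_unionC.
- rewrite (_ : sdiff _ _ = sdiff A S)//.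
  by rewrite /sdiff !setDE !setCK setUC ![~` _ `&` _]setIC.
Qed.

Lemma approximableU A B : measurable A -> measurable B ->
  approximable A -> approximable B -> approximable (A `|` B).
Proof.
move=> mA mB HA HB e e0; have e20 : 0 < e / 2 by rewrite divr_gt0.
have [k [S [mS tS muS]]] := HA _ e20.
have [m [T [mT tT muT]]] := HB _ e20.
exists (maxn k m), (S `|` T); split.
- exact: measurableU.
- by apply: dyadic_unionU; [apply: dyadic_union_le tS;
    rewrite leq_maxl|apply: dyadic_union_le tT; rewrite leq_maxr].
rewrite [e]splitr EFinD; apply: le_trans (leeD muS muT).
apply: (le_trans _ (measureU2 _ _ _)); last 2 first.
- exact: mBD.
- exact: mBD.
apply: le_measure; rewrite ?inE.
- by apply: mBD; exact: measurableU.
- by apply: measurableU; exact: mBD.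
move=> x [Bx [[[Ax|Bx'] nST]|[[Sx|Tx] nAB]]].
- by left; split=> //; left; split=> // Sx; apply: nST; left.
- by right; split=> //; left; split=> // Sx; apply: nST; right.
- by left; split=> //; right; split=> // Ax; apply: nAB; left.
- by right; split=> //; right; split=> // Bx'; apply: nAB; right.
Qed.

Lemma approximable0 : approximable set0.
Proof.
move=> e e0; exists 0%N, set0; split => //; first by left; rewrite setI0.
by rewrite /sdiff setD0 setU0 setI0 measure0 lee_fin ltW.
Qed.

(** Since [B0] has finite measure, continuity from above makes the part of the union missed by a
    finite subunion smaller than [e / 2]; the finite subunion is approximated with the other half of
    the error. *)
Lemma approximable_bigcup (F : (set Rn)^nat) : (forall k, measurable (F k)) ->
  (forall k, approximable (F k)) -> approximable (\bigcup_k F k).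
Proof.
move=> mF HF e e0; have e20 : 0 < e / 2 by rewrite divr_gt0.
pose U m := \big[setU/set0]_(k < m) F k.
have mU m : measurable (U m) by exact: bigsetU_measurable.
have HU m : approximable (U m).
  rewrite /U; elim: m => [|m IH]; first by rewrite big_ord0; exact: approximable0.
  by rewrite big_ord_recr/=; apply: approximableU => //; exact: mU.
pose T m := B0 `&` (\bigcup_k F k `\` U m).
have mT m : measurable (T m).
  by apply: measurableI => //; apply: measurableD => //; exact: bigcup_measurable.
have T0 : \bigcap_m T m = set0.
  rewrite -subset0 => x Tx; have [_ [[k _ Fk] _]] := Tx 0%N I.
  have [_ [_ ]] := Tx k.+1 I; apply.
  by rewrite /U -bigcup_mkord; exists k => /=.
have : (mu \o T) m @[m --> \oo] --> mu (\bigcap_m T m).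
  apply: nonincreasing_cvg_mu => //.
  - apply: le_lt_trans B0fin; apply: le_measure; rewrite ?inE//.
    exact: subIsetl.
  - exact: bigcap_measurable.
  - move=> p q pq; apply/subsetPset => x [Bx [Fx nU]]; split=> //; split=> // Up.
    by apply: nU; apply: subset_bigsetU Up.
rewrite T0 measure0 => /fine_cvgP[Tfin /cvgrPdist_lt /(_ _ e20) Tlt].
have [m [mTfin mTlt]] : exists m, T m = T m /\ (mu (T m) < (e / 2)%:E)%E.
  near \oo => m; exists m; split=> //.
  have fT : mu (T m) \is a fin_num by near: m; exact: Tfin.
  have : `|0 - fine (mu (T m))| < e / 2 by near: m; exact: Tlt.
  rewrite sub0r normrN ger0_norm ?fine_ge0//.
  by rewrite -lte_fin fineK.
have [k [S [mS tS muS]]] := HU m _ e20.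
exists k, S; split=> //.
rewrite [e]splitr EFinD; apply: le_trans (leeD (ltW mTlt) muS).
apply: (le_trans _ (measureU2 _ _ _)) => //; last exact: mBD.
apply: le_measure; rewrite ?inE.
- by apply: mBD => //; exact: bigcup_measurable.
- by apply: measurableU => //; exact: mBD.
move=> x [Bx [[Fx nS]|[Sx nF]]].
- have [Ux|nU] := pselect (U m x); [right|left]; split=> //.
  by left.
- right; split=> //; right; split=> // Ux; apply: nF.
  by move: Ux; rewrite /U -bigcup_mkord => -[j _ Fj]; exists j.
Unshelve. all: by end_near. Qed.

Lemma approximable_halfspace (i : 'I_n) (q : R) :
  approximable [set x : Rn | q <= x ord0 i].
Proof.
move=> e e0.
have v0 := vol_gt0 l0_gt0.
have [k hk] : exists k, vol l0 / 2 ^+ k < e.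
  have : vol l0 * (2^-1 ^+ k) @[k --> \oo] --> vol l0 * 0.
    by apply: cvgM; [exact: cvg_cst|apply: cvg_expr; rewrite ger0_norm// invf_lt1// ltr1n].
  rewrite mulr0 => /cvgrPdist_lt /(_ _ e0) H; near \oo => k; exists k.
  have : `|0 - vol l0 * 2^-1 ^+ k| < e by near: k; exact: H.
  rewrite sub0r normrN exprVn ger0_norm// mulr_ge0 ?(ltW v0)//.
have [S [mS tS muS]] := halfspace_dyadic_union i q (round_robin n k) a0 l0_gt0.
exists k, S; split=> //; apply: (le_trans muS).
by rewrite lee_fin count_round_robin ltW.
Unshelve. all: by end_near. Qed.

Lemma approximable_borel E : borel E -> approximable E.
Proof.
move=> bE; suff [] : measurable E /\ approximable E by [].
apply: (@borel_sigma_induction _ _ [set A | measurable A /\ approximable A]) bE.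
  split => /=; first by split=> //; exact: approximable0.
  - move=> A [mA HA]; rewrite setTD; split; first exact: measurableC.
    exact: approximableC.
  - move=> F GF; split; first by apply: bigcupT_measurable => k; have [] := GF k.
    by apply: approximable_bigcup => k; have [] := GF k.
move=> i q; split; last exact: approximable_halfspace.
exact: measurable_halfspace.
Qed.

(** Cutting with [B0] makes the measure finite, so that a Borel hull exceeds the set by at most
    [e / 2]; the hull itself falls under the Borel case. *)
Lemma approximable_measurable A : measurable A -> approximable A.
Proof.
move=> mA e e0; have e20 : 0 < e / 2 by rewrite divr_gt0.
have mAB : measurable (A `&` B0) by exact: measurableI.
have fAB : (mu (A `&` B0) < +oo)%E.
  by apply: le_lt_trans B0fin; apply: le_measure; rewrite ?inE//; exact: subIsetr.
have [E bE [AE muE]] := borel_hull fAB e20.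
have mE := borel_measurable bE.
have [k [S [mS tS muS]]] := approximable_borel bE e20.
have muD : (mu (E `\` (A `&` B0)) <= (e / 2)%:E)%E.
  have fin : mu (A `&` B0) \is a fin_num by rewrite ge0_fin_numE//; exact: mu_ge0.
  have lE : (mu E < +oo)%E by rewrite (le_lt_trans muE)// -(fineK fin) -EFinD ltry.
  have fE : mu E \is a fin_num by rewrite ge0_fin_numE.
  rewrite measureD//= (setIidr AE); move: muE; rewrite -(fineK fin).
  by rewrite -(fineK fE) -EFinD -EFinB !lee_fin lerBlDl.
exists k, S; split=> //.
rewrite [e]splitr EFinD; apply: le_trans (leeD muD muS).
apply: (le_trans _ (measureU2 _ _ _)); last 2 first.
- exact: measurableD.
- exact: mBD.
apply: le_measure; rewrite ?inE.
- exact: mBD.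
- by apply: measurableU; [exact: measurableD|exact: mBD].
move=> x [Bx [[Ax nS]|[Sx nA]]].
- by right; split=> //; left; split=> //; exact: AE.
- have [Ex|nE] := pselect (E x); [left|right]; split=> //.
    by move=> [].
  by right.
Qed.

End dyadic_approximation.

(** * Exponential integrability *)

Section exponential_estimate.
Variables (R : realType) (n : nat).
Local Notation Rn := 'rV[R]_n.
Local Notation mu := (@lebesgue_Rn R n).
Implicit Types (a l : 'I_n -> R) (S : set Rn) (s : seq 'I_n).
Variables (U : Rn -> R) (G : 'I_n -> Rn -> R).
Hypothesis iU : mu.-integrable setT (EFin \o U).
Hypothesis iG : forall i, mu.-integrable setT (EFin \o G i).

Definition avg a l : R := (\int[mu]_(x in box a l) U x) / vol l.

Definition osc a l : R := \sum_(i < n) l i * (\int[mu]_(x in box a l) `|G i x|) / vol l.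

Definition inside (a0 b0 : 'I_n -> R) a l := forall j, a0 j <= a j /\ a j + l j <= b0 j.

Lemma expR_le_1D2 (y : R) : 0 <= y <= 2^-1 -> expR y <= 1 + 2 * y.
Proof.
move=> /andP[y0 y1]; have := expR_ge1Dx (- y); rewrite expRN => H.
have y2 : 0 < 1 - y by lra.
have : expR y <= (1 - y)^-1 by rewrite -[expR y]invrK lef_pV2 ?posrE ?invr_gt0 ?expR_gt0.
move/le_trans; apply; rewrite invf_ple ?posrE//; last by lra.
rewrite -div1r ler_pdivrMr; nra.
Qed.

(** Put [y = k * x / 2] and [z = 4 * k * w]. The bracket is [2 * (1 + z - 4 * y)] and
    [expR y <= 1 + 2 * y], while [(1 + 2 * y) * (1 + z - 4 * y)] exceeds [1 + z] by
    [2 * y * (z - 1) - 8 * y ^+ 2], which is nonpositive since [z <= 1]. *)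
Lemma expR_osc_step (k x w w1 w2 : R) : 0 < k -> 0 <= x <= w -> 4 * k * w <= 1 ->
  w1 + w2 = 2 * w - x ->
  expR (k * x / 2) * ((1 + 4 * k * w1) + (1 + 4 * k * w2)) <= 2 * (1 + 4 * k * w).
Proof.
move=> k0 /andP[x0 xw] kw ww; set y := k * x / 2.
have kx : k * x <= k * w by rewrite ler_pM2l.
have kx0 : 0 <= k * x by rewrite mulr_ge0// ltW.
have y0 : 0 <= y by rewrite divr_ge0.
have y1 : y <= k * w / 2 by rewrite /y ler_pM2r.
have Ey : expR y <= 1 + 2 * y.
  by apply: expR_le_1D2; rewrite y0/= /y; lra.
have -> : 1 + 4 * k * w1 + (1 + 4 * k * w2) = 2 * (1 + 4 * k * w - 4 * y).
  have -> : w2 = 2 * w - x - w1 by lra.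
  by rewrite /y; field.
rewrite mulrCA ler_pM2l//.
have p0 : 0 <= 1 + 4 * k * w - 4 * y by lra.
apply: (le_trans (ler_wpM2r p0 Ey)); nra.
Qed.

Lemma RintegralU_halves a l i (f : Rn -> R) S : (forall j, 0 < l j) -> measurable S ->
  mu.-integrable (box a l) (EFin \o f) ->
  \int[mu]_(x in box a l `&` S) f x =
  \int[mu]_(x in box a (halve l i) `&` S) f x +
  \int[mu]_(x in box (midcorner a l i) (halve l i) `&` S) f x.
Proof.
move=> l0 mS int_f; rewrite (box_halves a i l0) setIUl Rintegral_setU//.
- by apply: measurableI => //; exact: measurable_box.
- by apply: measurableI => //; exact: measurable_box.
- rewrite -setIUl -(box_halves a i l0); apply: integrableS int_f.
  + exact: measurable_box.
  + by apply: measurableI => //; exact: measurable_box.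
  + exact: subIsetl.
- apply/disj_setPS => x [[x1 _] [x2 _]].
  by rewrite -(box_halves_disj a l i).
Qed.

Lemma integrable_box_cst a l (k : R) : (forall j, 0 < l j) ->
  mu.-integrable (box a l) (EFin \o cst k).
Proof.
move=> l0; have mB := @measurable_box R n a l.
apply: (@measurable_bounded_integrable _ _ _ mu) => //.
  by rewrite /= lebesgue_Rn_box// ltry.
exists `|k|; split=> // M kM x _ /=; exact: ltW.
Qed.

Lemma Rintegral_box_cst a l (k : R) : (forall j, 0 < l j) ->
  \int[mu]_(x in box a l) k = k * vol l.
Proof.
move=> l0; rewrite Rintegral_cst; last exact: measurable_box.
by rewrite /= lebesgue_Rn_box.
Qed.

Variable c : R.
Hypothesis c0 : 0 < c.
(* The tangent line of [exp] at [t], taken at [c * U]: a lower bound of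
   [expR (c * U)] that is affine in [U], so that averaging it over a box gives
   the same expression at [avg], and it passes to the limit in [S]. *)
Definition tangent (t : R) (x : Rn) : R := expR t * (1 - t + c * U x).

Lemma integrable_tangent t a l : (forall j, 0 < l j) ->
  mu.-integrable (box a l) (EFin \o tangent t).
Proof.
move=> l0; have mB := @measurable_box R n a l.
have i1 := integrable_box_cst a (1 - t) l0.
have i2 := integrableZl mB c (integrableS measurableT mB (@subsetT _ _) iU).
exact: (integrableZl mB (expR t) (integrableD mB i1 i2)).
Qed.

Lemma Rintegral_tangent t a l : (forall j, 0 < l j) ->
  \int[mu]_(x in box a l) tangent t x = vol l * (expR t * (1 - t + c * avg a l)).
Proof.
move=> l0; have mB := @measurable_box R n a l.
have i1 := integrable_box_cst a (1 - t) l0.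
have iUB := integrableS measurableT mB (@subsetT _ _) iU.
have i2 := integrableZl mB c iUB.
rewrite (@RintegralZl _ _ _ _ _ (fun x => 1 - t + c * U x))//; last first.
  exact: (integrableD mB i1 i2).
rewrite (@RintegralD _ _ _ _ _ (cst (1 - t)) (fun x => c * U x))//.
rewrite Rintegral_box_cst// RintegralZl//.
have v0 := vol_gt0 l0; rewrite /avg.
by field; rewrite gt_eqF.
Qed.

Variables (a0 b0 : 'I_n -> R).
Hypothesis half_step : forall a l i, (forall j, 0 < l j) -> inside a0 b0 a l ->
  `|\int[mu]_(x in box (midcorner a l i) (halve l i)) U x - \int[mu]_(x in box a (halve l
      i)) U x|
    <= l i / 2 * \int[mu]_(x in box a l) `|G i x|.
Hypothesis osc_small : forall a l, (forall j, 0 < l j) -> inside a0 b0 a l ->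
  balanced l -> 4 * c * osc a l <= 1.

Lemma inside_lo a l i : (forall j, 0 < l j) -> inside a0 b0 a l ->
    inside a0 b0 a (halve l i).
Proof.
move=> l0 ia j; have [h1 h2] := ia j; split => //; rewrite /halve /upd.
by have := l0 j; case: eqP => [<-|_] *; lra.
Qed.

Lemma inside_hi a l i : (forall j, 0 < l j) -> inside a0 b0 a l ->
  inside a0 b0 (midcorner a l i) (halve l i).
Proof.
move=> l0 ia j; have [h1 h2] := ia j; rewrite /midcorner /halve /upd.
by have := l0 j; case: eqP => [<-|_] *; lra.
Qed.

Lemma osc_term_ge0 a l i : (forall j, 0 < l j) ->
  0 <= l i * (\int[mu]_(x in box a l) `|G i x|) / vol l.
Proof.
move=> l0; apply: divr_ge0; last exact/ltW/vol_gt0.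
by apply: mulr_ge0; [exact/ltW/l0|apply: Rintegral_ge0 => x _; exact: normr_ge0].
Qed.

Lemma osc_ge0 a l : (forall j, 0 < l j) -> 0 <= osc a l.
Proof. by move=> l0; apply: sumr_ge0 => i _; exact: osc_term_ge0. Qed.

(** The average over the box is the midpoint of the two half averages, which differ by at most [x].
    In [osc], halving the volume doubles each averaged integral; for the term of direction [i] the
    halved side compensates this, so that term sums to [x] over the halves and every other term to
    twice its value. *)
Lemma avg_halves a l i : (forall j, 0 < l j) -> inside a0 b0 a l ->
  let x := l i * (\int[mu]_(x in box a l) `|G i x|) / vol l in
  [/\ avg a (halve l i) <= avg a l + x / 2, avg (midcorner a l i) (halve l i) <=
      avg a l + x / 2,
      osc a (halve l i) + osc (midcorner a l i) (halve l i) = 2 * osc a l - x &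
          0 <= x <= osc a l].
Proof.
move=> l0 ia x; have v0 := vol_gt0 l0; have vn0 : vol l != 0 by rewrite gt_eqF.
have mB := @measurable_box R n a l.
have sp f : mu.-integrable setT (EFin \o f) -> \int[mu]_(x in box a l) f x =
    \int[mu]_(x in box a (halve l i)) f x + \int[mu]_(x in box (midcorner a l i) (halve l
        i)) f x.
  move=> int_f; have := @RintegralU_halves a l i f setT l0 measurableT.
  by rewrite !setIT; apply; exact: integrableS int_f.
have := half_step i l0 ia; rewrite ler_norml => /andP[].
set Ih := \int[mu]_(x in box (midcorner a l i) _) U x;
    set Il := \int[mu]_(x in box a (halve l i)) U x.
set Ig := l i / 2 * _ => h1 h2.
have t_ge0 j : 0 <= l j * (\int[mu]_(x in box a l) `|G j x|) / vol l.
  exact: osc_term_ge0.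
have xE : x / 2 * vol l = l i / 2 * (\int[mu]_(x in box a l) `|G i x|).
  by rewrite /x; field.
split.
- rewrite /avg vol_lo -(ler_pM2r v0) mulrDl xE -/Ig divfK//.
  by rewrite (sp U iU) -/Il -/Ih invfM invrK mulrA mulrAC divfK//; lra.
- rewrite /avg vol_lo -(ler_pM2r v0) mulrDl xE -/Ig divfK//.
  rewrite (sp U iU) -/Il -/Ih invfM invrK mulrA mulrAC divfK//.
  by rewrite mulr_natr mulr2n addrAC lerD2r -lerBlDl.
- rewrite /osc -big_split/= (bigD1 i)//= [in RHS](bigD1 i)//= -/x.
  have -> : \sum_(j < n | j != i)
      (halve l i j * (\int[mu]_(x in box a (halve l i)) `|G j x|) / vol (halve l i) +
       halve l i j * (\int[mu]_(x in box (midcorner a l i) (halve l i)) `|G j x|) / vol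
           (halve l i))
    = 2 * \sum_(j < n | j != i) l j * (\int[mu]_(x in box a l) `|G j x|) / vol l.
    rewrite mulr_sumr; apply: eq_bigr => j ji.
    rewrite vol_lo (sp (fun x => `|G j x|)); last exact: integrable_norm.
    by rewrite /halve /upd (negbTE ji); field.
  rewrite /x vol_lo (sp (fun x => `|G i x|)); last exact: integrable_norm.
  by rewrite /halve /upd eqxx; field.
- rewrite /x t_ge0/= /osc (bigD1 i)//= lerDl.
  by apply: sumr_ge0 => j _.
Qed.

(** Induction on the halvings, from the cells upwards. On a cell inside [S] the integral is the
    volume times the tangent at the average, and the factor with [osc] is at least 1; merging two
    halves is [expR_osc_step]. The bound depends neither on [s] and [S] nor on [t], as the passage
    to arbitrary sets and levels requires. *)
Lemma tangent_dyadic_union s a l S t : (forall j, 0 < l j) -> inside a0 b0 a l ->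
  balanced l -> splits_longest s l -> measurable S -> dyadic_union s a l S ->
  \int[mu]_(x in box a l `&` S) tangent t x <=
    vol l * expR (c * avg a l) * (1 + 4 * c * osc a l).
Proof.
move=> + + + + mS.
elim: s a l => [|i s IH] a l l0 ia bl.
  move=> _ /= HS; have v0 := vol_gt0 l0; have o0 := osc_ge0 a l0.
  have rhs : vol l * expR (c * avg a l) <=
      vol l * expR (c * avg a l) * (1 + 4 * c * osc a l).
    rewrite ler_peMr ?mulr_ge0 ?expR_ge0 ?(ltW v0)// lerDl.
    by rewrite !mulr_ge0 ?(ltW c0).
  case: HS => [->|/setIidl ->].
    rewrite Rintegral_set0 (le_trans _ rhs)// mulr_ge0 ?expR_ge0 ?(ltW v0)//.
  rewrite Rintegral_tangent// (le_trans _ rhs)// ler_pM2l//.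
  have -> : expR (c * avg a l) = expR t * expR (c * avg a l - t).
    by rewrite -expRD addrCA subrr addr0.
  rewrite ler_pM2l ?expR_gt0//; have := expR_ge1Dx (c * avg a l - t); lra.
move=> [li al] [tlo thi]; have l'0 := lo_gt0 i l0.
rewrite (RintegralU_halves i l0 mS (integrable_tangent t a l0)).
have bl' := balanced_lo l0 li bl.
have Hlo := IH _ _ l'0 (inside_lo i l0 ia) bl' al tlo.
have Hhi := IH _ _ l'0 (inside_hi i l0 ia) bl' al thi.
apply: (le_trans (lerD Hlo Hhi)).
have [] := avg_halves i l0 ia; set x := _ / vol l; move=> Alo Ahi Eosc /andP[x0 xo].
have sm := osc_small l0 ia bl.
have v0 := vol_gt0 l0; have o0 := osc_ge0 a l0.
have olo := osc_ge0 a l'0; have ohi := osc_ge0 (midcorner a l i) l'0.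
set e := expR (c * avg a l); set E := expR (c * x / 2).
have e0 : 0 < e by exact: expR_gt0.
have Elo : expR (c * avg a (halve l i)) <= e * E.
  by rewrite /e /E -expRD ler_expR -mulrA -mulrDr (ler_pM2l c0).
have Ehi : expR (c * avg (midcorner a l i) (halve l i)) <= e * E.
  by rewrite /e /E -expRD ler_expR -mulrA -mulrDr (ler_pM2l c0).
rewrite vol_lo.
apply: (@le_trans _ _ (vol l / 2 * (e * E) * (1 + 4 * c * osc a (halve l i)) +
    vol l / 2 * (e * E) * (1 + 4 * c * osc (midcorner a l i) (halve l i)))).
  have v20 : 0 < vol l / 2 by rewrite divr_gt0.
  have c40 : 0 <= 4 * c by rewrite mulr_ge0// ltW.
  apply: lerD.
    apply: (ler_wpM2r (addr_ge0 ler01 (mulr_ge0 c40 olo))).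
    by rewrite (ler_pM2l v20); exact: Elo.
  apply: (ler_wpM2r (addr_ge0 ler01 (mulr_ge0 c40 ohi))).
  by rewrite (ler_pM2l v20); exact: Ehi.
rewrite -mulrDr.
have := expR_osc_step c0 (introT andP (conj x0 xo)) sm Eosc; rewrite -/E.
set q := _ + _ => Eq.
have -> : vol l / 2 * (e * E) * q = vol l / 2 * e * (E * q) by rewrite !mulrA.
have -> : vol l * e * (1 + 4 * c * osc a l) = vol l / 2 * e * (2 * (1 + 4 * c * osc a l)).
  by field.
have p0 : 0 <= vol l / 2 * e by rewrite mulr_ge0 ?divr_ge0// ltW.
exact: (ler_wpM2l p0 Eq).
Qed.

End exponential_estimate.

(** * From bounds on tangents to integrability of the exponential *)

Section exponential_integrability.
Variables (R : realType) (n : nat).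
Local Notation Rn := 'rV[R]_n.
Local Notation mu := (@lebesgue_Rn R n).
Variables (U : Rn -> R) (G : 'I_n -> Rn -> R).
Hypothesis iU : mu.-integrable setT (EFin \o U).
Hypothesis iG : forall i, mu.-integrable setT (EFin \o G i).
Variables (a0 : 'I_n -> R) (L : R).
Hypothesis L0 : 0 < L.
Let l0 : 'I_n -> R := fun=> L.
Let b0 : 'I_n -> R := fun j => a0 j + L.
Let l0_gt0 (j : 'I_n) : 0 < l0 j. Proof. exact: L0. Qed.
Local Notation B0 := (box a0 l0).
Let mB0 : measurable B0. Proof. exact: measurable_box. Qed.
Let mU : measurable_fun setT U.
Proof. by apply/measurable_EFinP; exact: measurable_int iU. Qed.
Hypothesis half_step : forall a l i, (forall j, 0 < l j) -> inside a0 b0 a l ->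
  `|\int[mu]_(x in box (midcorner a l i) (halve l i)) U x - \int[mu]_(x in box a (halve l
      i)) U x|
    <= l i / 2 * \int[mu]_(x in box a l) `|G i x|.
Variable c : R.
Hypothesis c0 : 0 < c.
Hypothesis osc_small : forall a l, (forall j, 0 < l j) -> inside a0 b0 a l ->
  balanced l -> 4 * c * osc G a l <= 1.

Let C : R := vol l0 * expR (c * avg U a0 l0) * (1 + 4 * c * osc G a0 l0).

Let C0 : 0 <= C.
Proof.
rewrite /C !mulr_ge0 ?expR_ge0 ?(ltW (vol_gt0 l0_gt0))//.
by rewrite addr_ge0// !mulr_ge0 ?(ltW c0)// osc_ge0.
Qed.

(** For fixed [t] the tangent is integrable, so its integral varies little when [A] is replaced by a
    dyadic union close to it in measure. *)
Lemma Rintegral_tangent_le A t : measurable A ->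
  \int[mu]_(x in B0 `&` A) tangent U c t x <= C.
Proof.
move=> mA; apply/ler_addgt0Pr => e e0.
pose F := tangent U c t \_ B0.
have iF : mu.-integrable setT (EFin \o F).
  have := integrable_tangent iU c t a0 l0_gt0.
  by move/(integrable_mkcond _ mB0); rewrite restrict_EFin.
have [d [d0 dP]] := integral_normr_continuous iF e0.
have d20 : 0 < d / 2 by rewrite divr_gt0.
have [k [S [mS tS muS]]] := approximable_measurable a0 L0 mA d20.
pose Z := B0 `&` sdiff A S.
have mZ : measurable Z by apply: measurableI => //; exact: measurable_sdiff.
have Ze : \int[mu]_(x in Z) `|F x| < e.
  by apply: dP => //; apply: (le_lt_trans muS); rewrite lte_fin; lra.
have ind (D : set Rn) : measurable D -> measurable_fun setT (\1_D : Rn -> R) /\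
    (forall x, `|\1_D x : R| <= 1).
  move=> mD; split; first exact: measurable_indic.
  by move=> x; rewrite indicE normr_nat lern1 leq_b1.
have imul (f : Rn -> R) D : measurable D -> mu.-integrable setT (EFin \o f) ->
    mu.-integrable setT (EFin \o (fun x => f x * \1_D x)).
  by move=> /ind[m1 m2] int_f; exact: integrable_mul_bounded m2.
have restr D : \int[mu]_(x in B0 `&` D) tangent U c t x = \int[mu]_x (F x * \1_D x).
  by rewrite Rintegral_mkcondl -Rintegral_mul_indic.
apply: (@le_trans _ _ (\int[mu]_(x in B0 `&` S) tangent U c t x + e)); last first.
  rewrite lerD2r; apply: (tangent_dyadic_union iU iG c0 half_step osc_small t) tS => //.
  - by move=> i j; rewrite /l0 ler_peMl ?ler1n// ltW.
  - exact: splits_longest_round_robin.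
apply: (@le_trans _ _ (\int[mu]_(x in B0 `&` S) tangent U c t x +
    \int[mu]_(x in Z) `|F x|)).
  have iFS := imul F S mS iF.
  have iFZ := imul (fun x => `|F x|) Z mZ (integrable_norm iF).
  rewrite !restr (Rintegral_mul_indic (fun x => `|F x|) Z) -(RintegralD measurableT iFS
      iFZ).
  apply: (le_Rintegral measurableT (imul F A mA iF) (integrableD measurableT iFS iFZ)).
  (* Pointwise, [F] on [A] is at most [F] on [S] plus [|F|] on the symmetric difference. *)
  - move=> x _; rewrite !indicE.
    have [xB|xB] := pselect (B0 x); last first.
      by rewrite /F patchE memNset// normr0 !mul0r addr0.
    have [xA|xA] := pselect (A x); have [xS|xS] := pselect (S x).
    + by rewrite (mem_set xA) (mem_set xS) lerDl mulr_ge0.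
    + rewrite (mem_set xA) (memNset xS) mem_set ?mulr0 ?mulr1 ?add0r ?ler_norm//.
      by split=> //; left.
    + rewrite (mem_set xS) (memNset xA) mem_set ?mulr0 ?mulr1.
        by rewrite -lerBlDl sub0r (le_trans (ler_norm _))// normrN.
      by split=> //; right.
    + by rewrite !(memNset xA) !(memNset xS) !mulr0 add0r mulr_ge0.
by rewrite lerD2l ltW.
Qed.

Let level (k : nat) : set Rn := B0 `&` [set x | k%:R <= U x].

Let measurable_ge (k : nat) : measurable [set x | k%:R <= U x].
Proof.
rewrite (_ : [set x | _] = U @^-1` `[k%:R, +oo[%classic).
  by rewrite -[X in measurable X]setTI; exact: mU.
by apply/seteqP; split => x /=; rewrite in_itv/= andbT.
Qed.

(** Chebyshev's inequality for the tangent at [t = c * k], which is at least [expR t] wherever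
    [k <= U]. *)
Lemma level_measure k : (mu (level k) <= (C * expR (- (c * k%:R)))%:E)%E.
Proof.
have mk : measurable (level k) by apply: measurableI.
have fk : mu (level k) \is a fin_num.
  rewrite ge0_fin_numE; last exact: outer_measure_ge0.
  apply: (@le_lt_trans _ _ (mu B0)); last by rewrite lebesgue_Rn_box// ltry.
  by apply: le_measure; rewrite ?inE//; exact: subIsetl.
rewrite -(fineK fk) lee_fin expRN ler_pdivlMr ?expR_gt0//.
apply: le_trans (Rintegral_tangent_le (c * k%:R) (measurable_ge k)).
rewrite mulrC -Rintegral_cst//; apply: le_Rintegral => //.
- apply: integrableS (integrable_box_cst a0 (expR (c * k%:R)) l0_gt0) => //.
  exact: subIsetl.
- apply: integrableS (integrable_tangent iU c (c * k%:R) a0 l0_gt0) => //.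
  exact: subIsetl.
- move=> x [_ /= kU]; rewrite /tangent ler_peMr ?expR_ge0//.
  have : c * k%:R <= c * U x by rewrite ler_pM2l.
  lra.
Qed.

(** Summation over integer levels. The tail rate [c] has to exceed the exponent 2; with [c = 4] the
    term of level [k] is at most a constant times [expR (- 2 * k)]. *)
Lemma expR_integral_lty : c = 4 ->
  (\int[mu]_(x in B0) (expR (2 * U x))%:E < +oo)%E.
Proof.
move=> c4.
pose f (k : nat) (x : Rn) : \bar R := (expR (2 * k.+1%:R) * \1_(level k) x)%:E.
have mk k : measurable (level k) by apply: measurableI.
have f0 k x : (0 <= f k x)%E by rewrite lee_fin mulr_ge0 ?expR_ge0// indicE.
have mf k : measurable_fun B0 (f k).
  apply: measurable_funTS; apply/measurable_EFinP; apply: measurable_funM.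
    exact: measurable_cst.
  exact: measurable_indic.
have ptw x : B0 x -> ((expR (2 * U x))%:E <= 1 + \sum_(k <oo) f k x)%E.
  move=> xB; have [U0|U0] := leP 0 (U x); last first.
    rewrite -[leLHS]adde0; apply: leeD; last exact: nneseries_ge0.
    by rewrite lee_fin expR_le1; lra.
  (* The term of index [k], the integer part of [U x], alone dominates; its weight has [k.+1] in the
     exponent because [U x < k + 1]. *)
  pose k := Num.truncn (U x); have /andP[k1 k2] := truncn_itv U0.
  apply: (@le_trans _ _ (f k x)).
    rewrite /f indicE mem_set ?mulr1; last by split.
    by rewrite lee_fin ler_expR ler_pM2l// ltW.
  rewrite -[leLHS]add0e; apply: leeD => //.
  apply: (@le_trans _ _ (\sum_(0 <= j < k.+1) f j x)%E).
    by rewrite big_nat_recr//= leeDr// sume_ge0.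
  by apply: (@nneseries_lim_ge R (f ^~ x) xpredT 0%N k.+1) => j _ _; exact: f0.
have mS : measurable_fun B0 (fun x => \sum_(k <oo) f k x)%E.
  apply: (@ge0_emeasurable_sum _ _ _ B0 f xpredT); last by move=> k _; exact: mf.
  by move=> k x _ _; exact: f0.
have S0 x : B0 x -> (0 <= \sum_(k <oo) f k x)%E.
  by move=> _; apply: nneseries_ge0 => k _ _; exact: f0.
have one0 x : B0 x -> (0 <= 1 :> \bar R)%E by move=> _; exact: lee01.
have m1 : measurable_fun B0 (fun=> 1 : \bar R)%E by exact: measurable_cst.
have mE : measurable_fun B0 (fun x => (expR (2 * U x))%:E).
  apply/measurable_EFinP; apply: measurable_funTS.
  have m2U : measurable_fun setT (fun x => 2 * U x).
    by apply: measurable_funM; [exact: measurable_cst|exact: mU].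
  by apply: measurableT_comp m2U; exact: measurable_expR.
have E0 x : B0 x -> (0 <= (expR (2 * U x))%:E)%E.
  by move=> _; rewrite lee_fin expR_ge0.
apply: (@le_lt_trans _ _ (\int[mu]_(x in B0) (1 + \sum_(k <oo) f k x)%E)%E).
  apply: ge0_le_integral.
  - exact: mB0.
  - exact: E0.
  - exact: mE.
  - exact: (emeasurable_funD m1 mS).
  - exact: ptw.
rewrite (ge0_integralD mu mB0 one0 m1 S0 mS) (integral_cst mu mB0) mul1e.
rewrite lte_add_pinfty//; first by rewrite /= lebesgue_Rn_box// ltry.
rewrite (integral_nneseries mu mB0 mf (fun k x _ => f0 k x)).
(* The geometric series is taken as [K / 2 ^ k.+1], whose extra factor 2 in the denominator is
   compensated by the last factor of [K]. *)
pose K := C * expR 2 * 2.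
apply: (@le_lt_trans _ _ K%:E); last by rewrite ltry.
apply: le_trans (epsilon_trick0 xpredT _); last first.
  by rewrite /K mulr_ge0// mulr_ge0// expR_ge0.
apply: lee_nneseries.
  by move=> k _ _; exact: integral_ge0.
move=> k _; rewrite /f.
have mI : measurable_fun B0 (fun x => (\1_(level k) x : R)%:E).
  apply: measurable_funTS; apply/measurable_EFinP; exact: measurable_indic.
have I0 x : B0 x -> (0 <= (\1_(level k) x : R)%:E)%E by rewrite lee_fin indicE.
have K0 : (0 <= (expR (2 * k.+1%:R) : R)%:E)%E by rewrite lee_fin expR_ge0.
under eq_integral do rewrite EFinM.
rewrite (ge0_integralZl mu mB0 mI I0 K0) (integral_indic mu mB0 (mk k)).
rewrite setIC setIA setIid -/(level k).
apply: (le_trans (lee_wpmul2l K0 (level_measure k))).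
rewrite -EFinM lee_fin c4 mulrCA -expRD.
rewrite (_ : 2 * _ + _ = 2 + (- 2) * k%:R); last by rewrite -natr1; ring.
rewrite expRD expRM_natr.
have -> : K / (2 ^ k.+1)%:R = C * (expR 2 * 2^-1 ^+ k).
  rewrite /K; move: C => C'; rewrite natrX exprS exprVn; field.
  by rewrite expf_neq0.
apply: (ler_wpM2l C0); apply: (ler_wpM2l (expR_ge0 _)).
apply: lerXn2r; rewrite ?nnegrE ?expR_ge0//.
rewrite expRN lef_pV2 ?posrE ?expR_gt0//.
have := @expR_ge1Dx R 2; lra.
Qed.

End exponential_integrability.

(** * Smallness of [osc] on balanced boxes *)

Section local_exponential_integrability.
Variables (R : realType) (n : nat).
Local Notation Rn := 'rV[R]_n.
Local Notation mu := (@lebesgue_Rn R n).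
Implicit Types (V Omega : set Rn) (u g : Rn -> R) (x : Rn).

Lemma ball_sub_box x (r : R) : ball x r `<=` box (fun j => x ord0 j - r) (fun=> r *+ 2).
Proof.
move=> y [r0 xy] j; have := xy ord0 j; rewrite /ball/= ltr_norml => /andP[h1 h2].
by apply/andP; split; lra.
Qed.

Lemma measurable_ball_Rn x (r : R) : measurable (ball x r).
Proof. by apply: open_measurable_Rn; exact: ball_open. Qed.

(** On a set of finite measure L^m embeds into L^1, because [|u| <= 1 + |u| ^+ m] there. *)
Lemma Lp_integrable V (m : nat) u : measurable V -> (mu V < +oo)%E -> (0 < m)%N ->
  Lp V m%:R u -> mu.-integrable setT (EFin \o (u \_ V)) /\
  mu.-integrable setT (EFin \o (fun x => `|(u \_ V) x| ^+ m)).
Proof.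
move=> mV fV m0 Lu; have m1 : (1 <= m%:R :> R) by rewrite ler1n.
have iP : mu.-integrable setT (EFin \o (fun x => `|(u \_ V) x| ^+ m)).
  have := Lfun_integrable m1 Lu.
  by under eq_fun do rewrite powR_mulrn//.
split=> //.
have mu_V : measurable_fun setT (u \_ V).
  by have := Lu; rewrite /Lp inE => /andP[/[!inE]/=].
have mE : measurable_fun setT (EFin \o (u \_ V)) by exact/measurable_EFinP.
have iV : mu.-integrable setT (EFin \o (\1_V : Rn -> R)).
  have i1 : mu.-integrable V (EFin \o cst (1 : R)).
    apply: (measurable_bounded_integrable mV fV (measurable_cst _)).
    by exists 1; split=> // M M1 y _ /=; rewrite normr1 ltW.
  have /(integrable_mkcond _ mV) := i1; rewrite restrict_EFin.
  congr (_.-integrable _ _); apply/funext => y /=.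
  by rewrite patchE indicE; case: ifP.
apply: (le_integrable measurableT mE _ (integrableD measurableT iV iP)) => y _.
rewrite /= lee_fin [leRHS]ger0_norm ?addr_ge0 ?exprn_ge0 ?indicE//.
have [yV|yV] := boolP (y \in V); last by rewrite patchE (negbTE yV) normr0 expr0n gtn_eqF.
have [h|h] := leP `|(u \_ V) y| 1; first by rewrite (le_trans h)// lerDl exprn_ge0.
by rewrite ler_wpDl// ler_eXnr ?ltW.
Qed.

(** If [b] exceeds [t], then [(b / t) ^+ m >= 1]. The parameter [t] can be made small at the price
    of a large coefficient on the power of [b]. *)
Lemma ler_add_expn (b t : R) (m : nat) : 0 <= b -> 0 < t -> b <= t + b ^+ m.+1 / t ^+ m.
Proof.
move=> b0 t0; have [bt|tb] := leP b t.
  by rewrite ler_wpDr// divr_ge0 ?exprn_ge0 ?(ltW t0).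
rewrite ler_wpDl ?(ltW t0)// exprS -mulrA ler_peMr// -expr_div_n exprn_ege1//.
by rewrite ler_pdivlMr// mul1r ltW.
Qed.

Lemma balanced_vol (l : 'I_n -> R) i : (forall j, 0 < l j) -> balanced l ->
  l i ^+ n <= 2 ^+ n * vol l.
Proof.
move=> l0 bl; rewrite -[X in _ ^+ X]card_ord -[X in 2 ^+ X]card_ord.
rewrite -!prodr_const -big_split/=; apply: ler_prod => j _.
by rewrite (ltW (l0 i)) bl.
Qed.

Lemma ge0_subset_Rintegral (A B : set Rn) (f : Rn -> R) : measurable A -> measurable B ->
  A `<=` B -> (forall x, 0 <= f x) -> mu.-integrable setT (EFin \o f) ->
  \int[mu]_(x in A) f x <= \int[mu]_(x in B) f x.
Proof.
move=> mA mB AB f0 int_f.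
have H (D : set Rn) : measurable D -> mu.-integrable setT (EFin \o (fun x => f x * \1_D x)).
  move=> mD; apply: (integrable_mul_bounded (c := 1) int_f (measurable_indic mD)).
  by move=> x; rewrite indicE normr_nat lern1 leq_b1.
rewrite (Rintegral_mul_indic f A) (Rintegral_mul_indic f B).
apply: (le_Rintegral measurableT (H _ mA) (H _ mB)) => x _.
rewrite ler_wpM2l// !indicE; case: (boolP (x \in A)) => // xA.
by rewrite mem_set//; apply: AB; rewrite inE in xA.
Qed.

(* Young's inequality trades the scale-invariant averages of [|G i|] for
   [\int |G i| ^+ n], which is small on small cubes. *)
Lemma osc_le (G : 'I_n -> Rn -> R) (S : Rn -> R) (E : set Rn) (a l : 'I_n -> R) (t : R) :
  (0 < n)%N -> 0 < t -> measurable E ->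
  (forall i, mu.-integrable setT (EFin \o G i)) ->
  (forall i, mu.-integrable setT (EFin \o (fun x => `|G i x| ^+ n))) ->
  mu.-integrable setT (EFin \o S) -> (forall i x, `|G i x| ^+ n <= S x) ->
  (forall j, 0 < l j) -> balanced l -> box a l `<=` E ->
  osc G a l <= n%:R * (t + 2 ^+ n / t ^+ n.-1 * \int[mu]_(x in E) S x).
Proof.
move=> n0 t0 mE iG iGn iS GS l0 bl BE; have mB := @measurable_box R n a l.
have v0 := vol_gt0 l0.
have S0 x : 0 <= S x by rewrite (le_trans _ (GS (Ordinal n0) x))// exprn_ge0.
rewrite mulr_natl -[X in _ *+ X]card_ord -sumr_const; apply: ler_sum => i _.
have iB := integrableS measurableT mB (@subsetT _ _) (integrable_norm (iG i)).
have iBn := integrableS measurableT mB (@subsetT _ _) (iGn i).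
have iBS := integrableS measurableT mB (@subsetT _ _) iS.
rewrite -(RintegralZl (l i) mB iB) ler_pdivrMr//.
set k := l i ^+ n / t ^+ n.-1.
have tn0 : 0 <= (t ^+ n.-1)^-1 by rewrite invr_ge0 exprn_ge0// ltW.
have k0 : 0 <= k by apply: mulr_ge0 => //; rewrite exprn_ge0// ltW.
have i1 := integrable_box_cst a t l0.
have i2 := integrableZl mB k iBn.
apply: (@le_trans _ _ (\int[mu]_(x in box a l) (t + k * `|G i x| ^+ n))).
  apply: (le_Rintegral mB (integrableZl mB (l i) iB) (integrableD mB i1 i2)).
  move=> x _ /=; have := @ler_add_expn (l i * `|G i x|) t n.-1.
  rewrite prednK// => H; rewrite (le_trans (H _ t0))// ?mulr_ge0 ?(ltW (l0 i))//.
  by rewrite lerD2l /k exprMn mulrAC.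
have -> : \int[mu]_(x in box a l) (t + k * `|G i x| ^+ n) =
    t * vol l + k * \int[mu]_(x in box a l) (`|G i x| ^+ n).
  rewrite (@RintegralD _ _ _ _ _ (cst t) (fun x => k * `|G i x| ^+ n) mB i1 i2).
  by rewrite Rintegral_box_cst// (RintegralZl k mB iBn).
rewrite mulrDl lerD2l.
apply: (@le_trans _ _ (k * \int[mu]_(x in E) S x)).
  apply: (ler_wpM2l k0); apply: (@le_trans _ _ (\int[mu]_(x in box a l) S x)).
    by apply: (le_Rintegral mB iBn iBS) => x _; exact: GS.
  exact: ge0_subset_Rintegral.
rewrite [leRHS]mulrAC; apply: ler_wpM2r; first exact: Rintegral_ge0.
by rewrite /k [leRHS]mulrAC; apply: (ler_wpM2r tn0); exact: balanced_vol.
Qed.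

End local_exponential_integrability.

(** * Local integrability of both exponentials for W^{1,n} functions *)

Section local_integrability_W1n.
Variables (R : realType) (n : nat).
Local Notation Rn := 'rV[R]_n.
Local Notation mu := (@lebesgue_Rn R n).
Implicit Types (V Omega : set Rn) (x : Rn).

Lemma compactly_contained_ball Omega x : open Omega -> Omega x ->
  exists2 r : R, 0 < r & compactly_contained (ball x r) Omega.
Proof.
move=> oO Ox; have /nbhs_ballP[e /= e0 eO] : nbhs x Omega by exact: open_nbhs_nbhs.
have e20 : 0 < e / 2 by rewrite divr_gt0.
exists (e / 2) => //; rewrite /compactly_contained closure_ballE; split.
  apply: bounded_closed_compact; last exact: closed_ball_closed.
  rewrite closed_ballE//; exists (`|x| + e / 2); split; first exact: num_real.
  move=> M xM y /=.
  rewrite /closed_ball_ /= => xy; rewrite (le_trans _ (ltW xM))//.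
  by rewrite -[y](subKr x) (le_trans (ler_normB _ _))// lerD2l.
apply: subset_trans eO; apply: closed_ball_subset => //; lra.
Qed.

Lemma subset_integrable_fin (A B : set Rn) (f : Rn -> R) : measurable A -> measurable B ->
  A `<=` B -> measurable_fun B f -> (forall x, 0 <= f x) ->
  (\int[mu]_(x in B) (f x)%:E < +oo)%E -> (\int[mu]_(x in A) (f x)%:E < +oo)%E.
Proof.
move=> mA mB AB mf f0; apply: le_lt_trans.
have mfE : measurable_fun B (EFin \o f) by exact/measurable_EFinP.
have f0E x : B x -> (0 <= (f x)%:E)%E by move=> _; rewrite lee_fin.
exact: (ge0_subset_integral mu mA mB mfE f0E AB).
Qed.

(** A single radius serves [phi] and [- phi]: the half-box inequality and [osc] involve only
    [|G i|], which a change of sign of [phi] leaves unchanged. *)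
Lemma W1n_local_box Omega (phi : Rn -> R) x0 : (0 < n)%N -> open Omega ->
  W1p_loc Omega n%:R phi -> Omega x0 ->
  exists r, [/\ 0 < r, ball x0 r `<=` Omega, measurable_fun (ball x0 r) phi &
   forall s : R, `|s| = 1 ->
     (\int[mu]_(x in ball x0 r) (expR (2 * (s * phi x)))%:E < +oo)%E].
Proof.
move=> n0 oO W Ox.
have [rho rho0 VO] := compactly_contained_ball oO Ox.
set V := ball x0 rho in VO.
have oV : open V by exact: ball_open.
have mV : measurable V by exact: measurable_ball_Rn.
have fV : (mu V < +oo)%E.
  apply: (@le_lt_trans _ _ (mu (box (fun j => x0 ord0 j - rho) (fun=> rho *+ 2)))).
    by apply: le_measure; rewrite ?inE//; [exact: measurable_box|exact: ball_sub_box].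
  by rewrite lebesgue_Rn_box ?ltry// => _; rewrite mulrn_wgt0.
have [Lphi /choice[g gP]] : Lp V n%:R phi /\ forall i, exists g,
    Lp V n%:R g /\ weak_partial V i phi g.
  have [? H] := W V oV VO; split=> // i.
  by have [g ? ?] := H i; exists g.
have [iU _] := Lp_integrable mV fV n0 Lphi.
have iG i := Lp_integrable mV fV n0 (gP i).1.
pose U := phi \_ V; pose G i := g i \_ V.
have mphi : measurable_fun V phi.
  apply/(measurable_restrictT phi mV); apply/measurable_EFinP; exact: measurable_int iU.
have UG i psi : test_function V psi ->
    \int[mu]_x (U x * partial i psi x) = - \int[mu]_x (G i x * psi x).
  move=> /(gP i).2; rewrite Rintegral_mkcond => H.
  transitivity (\int[mu]_x ((fun x => phi x * partial i psi x) \_ V) x).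
    apply: eq_Rintegral => x _; rewrite /U !patchE; case: ifP => // _.
    by rewrite mul0r.
  rewrite H Rintegral_mkcond; congr (- _); apply: eq_Rintegral => x _.
  by rewrite /G !patchE; case: ifP => // _; rewrite mul0r.
(* One integrable majorant for all directions, so that absolute continuity is invoked once. *)
pose S x := \sum_(i < n) `|G i x| ^+ n.
have iS : mu.-integrable setT (EFin \o S).
  rewrite (_ : EFin \o S = fun x => (\sum_(i < n) (`|G i x| ^+ n)%:E)%E); last first.
    by apply/funext => x; rewrite /= /S sumEFin.
  by apply: integrable_sum => // i _; exact: (iG i).2.
have GS i x : `|G i x| ^+ n <= S x.
  by rewrite /S (bigD1 i)//= lerDl sumr_ge0// => j _; rewrite exprn_ge0.
have S0 x : 0 <= S x by apply: sumr_ge0 => i _; exact: exprn_ge0.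
(* Chosen so that [n * (t + t) = 1 / 16], which is the bound on [osc] required at the rate
   [c = 4]. *)
pose t : R := (32 * n%:R)^-1.
have nR0 : 0 < n%:R :> R by rewrite ltr0n.
have t0 : 0 < t by rewrite invr_gt0 mulr_gt0.
(* The value for which [2 ^+ n / t ^+ n.-1 * kap = t], so that both terms of [osc_le] are at most
   [t]. *)
pose kap : R := t ^+ n / 2 ^+ n.
have kap0 : 0 < kap by rewrite divr_gt0 ?exprn_gt0.
have [d [d0 dP]] := integral_normr_continuous iS kap0.
have [L [L0 Ld Lrho]] : exists L, [/\ 0 < L, L ^+ n < d & L <= rho].
  (* The bound 1 gives [L ^+ n <= L], then [d / 2] makes this smaller than [d], and [rho] keeps the
     closed cube of side [L] about [x0] inside [V]. *)
  exists (Num.min (Num.min 1 (d / 2)) rho).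
  have p0 : 0 < Num.min (Num.min 1 (d / 2)) rho by rewrite !lt_min ltr01 divr_gt0//.
  split=> //; last by rewrite ge_min lexx orbT.
  apply: (@le_lt_trans _ _ (Num.min (Num.min 1 (d / 2)) rho)).
    by apply: ler_iXnr => //; [exact: ltW|rewrite !ge_min lexx].
  by rewrite !gt_min; apply/orP; left; apply/orP; right; lra.
pose l0 : 'I_n -> R := fun=> L; pose a0 : 'I_n -> R := fun j => x0 ord0 j - L / 2.
have mB0 := @measurable_box R n a0 l0.
have l00 (j : 'I_n) : 0 < l0 j by [].
have B0V x : (forall j, a0 j <= x ord0 j <= a0 j + L) -> V x.
  move=> xB; split=> // i j; rewrite (ord1 i) /ball/=; have := xB j.
  by rewrite /a0 ltr_norml => /andP[h1 h2]; apply/andP; split; lra.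
have B0S : box a0 l0 `<=` V.
  by move=> x xB; apply: B0V => j; have /andP[-> /ltW ->] := xB j.
have kapS : \int[mu]_(x in box a0 l0) S x < kap.
  have -> : \int[mu]_(x in box a0 l0) S x = \int[mu]_(x in box a0 l0) `|S x|.
    by apply: eq_Rintegral => x _; rewrite (ger0_norm (S0 x)).
  apply: dP => //; rewrite /= lebesgue_Rn_box// lte_fin /l0.
  by rewrite prodr_const card_ord.
have in_box a l : inside a0 (fun j => a0 j + L) a l -> (forall j, 0 < l j) ->
    box a l `<=` box a0 l0.
  move=> ia l1 x xB j; have [h1 h2] := ia j; have /andP[h3 h4] := xB j.
  by rewrite /l0; apply/andP; split; lra.
have step s a l i : `|s| = 1 -> (forall j, 0 < l j) -> inside a0 (fun j => a0 j + L) a l ->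
  `|\int[mu]_(x in box (midcorner a l i) (halve l i)) (s * U x) - \int[mu]_(x in box a
      (halve l i)) (s * U x)|
    <= l i / 2 * \int[mu]_(x in box a l) `|G i x|.
  move=> s1 l1 ia.
  have iUh := integrableS measurableT (@measurable_box R n (midcorner a l i) (halve l i))
      (@subsetT _ _) iU.
  have iUl := integrableS measurableT (@measurable_box R n a (halve l i)) (@subsetT _ _) iU.
  rewrite (RintegralZl s (@measurable_box R n (midcorner a l i) (halve l i)) iUh).
  rewrite (RintegralZl s (@measurable_box R n a (halve l i)) iUl).
  rewrite -mulrBr normrM s1 mul1r.
  apply: (weak_partial_half_boxes l1 _ iU (iG i).1 (UG i)).
  by move=> x xa; apply: B0V => j; have [h1 h2] := ia j; have /andP[h3 h4] := xa j;
    apply/andP; split; lra.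
have osc_small a l : (forall j, 0 < l j) -> inside a0 (fun j => a0 j + L) a l ->
    balanced l -> 4 * 4 * osc G a l <= 1.
  move=> l1 ia bl.
  have := osc_le n0 t0 mB0 (fun i => (iG i).1) (fun i => (iG i).2) iS GS l1 bl (in_box _
      _ ia l1).
  set I := \int[mu]_(x in _) _ in kapS *.
  have It : 2 ^+ n / t ^+ n.-1 * I <= t.
    have tn : 0 < t ^+ n.-1 by rewrite exprn_gt0.
    have p2 : 0 < 2 ^+ n :> R by rewrite exprn_gt0.
    rewrite mulrAC ler_pdivrMr// -exprS prednK// mulrC -ler_pdivlMr//.
    exact: ltW.
  move=> H; have : osc G a l <= n%:R * (t + t).
    by rewrite (le_trans H)// ler_pM2l// lerD2l.
  have -> : n%:R * (t + t) = 16^-1 by rewrite /t; field; rewrite gt_eqF.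
  lra.
have L20 : 0 < L / 2 by rewrite divr_gt0.
have bB : ball x0 (L / 2) `<=` box a0 l0.
  move=> x /ball_sub_box xB j; have /andP[h1 h2] := xB j.
  by rewrite /a0 /l0; apply/andP; split; lra.
exists (L / 2); split => //.
- by apply: (subset_trans bB); apply: (subset_trans B0S); apply: subset_trans VO.2;
    exact: subset_closure.
- by apply: measurable_funS mphi => //; exact: subset_trans bB B0S.
move=> s s1.
have mE (D : set Rn) : D `<=` V -> measurable_fun D (fun x => expR (2 * (s * phi x))).
  move=> DV; have mD : measurable_fun D phi by apply: measurable_funS mphi.
  have m2 : measurable_fun D (fun x => 2 * (s * phi x)).
    by apply: measurable_funM; [exact: measurable_cst|apply: measurable_funM => //;
        exact: measurable_cst].
  by apply: measurableT_comp m2; exact: measurable_expR.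
apply: (subset_integrable_fin _ mB0 bB (mE _ B0S)) => [|x|].
- exact: measurable_ball_Rn.
- exact: expR_ge0.
have := @expR_integral_lty R n (fun x => s * U x) G (integrableZl measurableT s iU) (fun
    i => (iG i).1)
  a0 L L0 (fun a l i => step s a l i s1) 4 _ osc_small erefl.
have -> : (\int[mu]_(x in box a0 l0) (expR (2 * (s * phi x)))%:E =
  \int[mu]_(x in box a0 l0) (expR (2 * (s * U x)))%:E)%E.
  apply: eq_integral => x xB; rewrite /U patchE ifT//.
  by rewrite inE; apply: B0S; rewrite inE in xB.
by apply.
Qed.

End local_integrability_W1n.

(** * Local square integrability of the exponential, and Euclidean balls *)

Section exponential_of_W1n.
Variables (R : realType) (n : nat).
Local Notation Rn := 'rV[R]_n.
Local Notation mu := (@lebesgue_Rn R n).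

(** Removing one ball of the cover at a time keeps the pieces disjoint, so additivity of the
    integral is enough. *)
Lemma finite_cover_integral_lty (A : set Rn) (f : Rn -> R) (D : seq Rn) (r : Rn -> R) :
  measurable A -> measurable_fun A f -> (forall x, 0 <= f x) ->
  (forall x, x \in D -> (\int[mu]_(y in A `&` ball x (r x)) (f y)%:E < +oo)%E) ->
  (forall y, A y -> exists2 x, x \in D & ball x (r x) y) ->
  (\int[mu]_(y in A) (f y)%:E < +oo)%E.
Proof.
elim: D A => [|x D IH] A mA mf f0 fin cov.
  rewrite (_ : A = set0) ?integral_set0//.
  by rewrite -subset0 => y /cov[].
have mB := @measurable_ball_Rn R n x (r x).
have mAB := measurableI _ _ mA mB; have mAD := measurableD mA mB.
have AE : A = (A `&` ball x (r x)) `|` (A `\` ball x (r x)) by rewrite setUIDK.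
have mfE : measurable_fun A (EFin \o f) by exact/measurable_EFinP.
have disj : [disjoint (A `&` ball x (r x)) & (A `\` ball x (r x))].
  by apply/disj_setPS => y [[_ ?] [_]].
rewrite [X in (\int[_]_(_ in X) _)%E]AE (ge0_integral_setU mu mAB mAD _ _ disj);
    last 2 first.
- by rewrite -AE.
- by move=> y _; rewrite lee_fin.
rewrite lte_add_pinfty//; first by apply: fin; rewrite mem_head.
apply: IH => //.
- by apply: measurable_funS mf => //; exact: subDsetl.
- move=> z zD; apply: le_lt_trans (fin z _); last by rewrite in_cons zD orbT.
  have mZ := @measurable_ball_Rn R n z (r z).
  apply: (ge0_subset_integral mu (measurableI _ _ mAD mZ) (measurableI _ _ mA mZ)).
  + by apply: measurable_funS mfE => //; exact: subIsetl.
  + by move=> y _; rewrite lee_fin.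
  + by move=> y [[Ay _] zy].
- move=> y [Ay ny]; have [z] := cov y Ay; rewrite in_cons => /orP[/eqP ->//|zD zy].
  by exists z.
Qed.

Lemma expR_sqr (t : R) : `|expR t| ^+ 2 = expR (2 * t).
Proof. by rewrite ger0_norm ?expR_ge0// expRM_natl. Qed.

Lemma expR_Lp2_loc (Omega : set Rn) (phi : Rn -> R) : (0 < n)%N -> open Omega ->
  W1p_loc Omega n%:R phi -> Lp_loc Omega 2 (fun x => expR (phi x)).
Proof.
move=> n0 oO W V oV VO.
have mV := open_measurable_Rn oV.
have mphi : measurable_fun V phi.
  apply/(measurable_restrictT phi mV); have [+ _] := W V oV VO.
  by rewrite /Lp inE => /andP[/[!inE]/=].
have mexp : measurable_fun V (fun x => expR (phi x)).
  by apply: measurableT_comp mphi; exact: measurable_expR.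
have mexp2 : measurable_fun V (fun x => expR (2 * phi x)).
  have m2 : measurable_fun V (fun x => 2 * phi x).
    by apply: measurable_funM mphi; exact: measurable_cst.
  by apply: measurableT_comp m2; exact: measurable_expR.
have fin : (\int[mu]_(x in V) (expR (2 * phi x))%:E < +oo)%E.
  have /choice[r rP] : forall x, exists r : R, Omega x -> 0 < r /\
      (\int[mu]_(y in V `&` ball x r) (expR (2 * phi y))%:E < +oo)%E.
    move=> x; have [Ox|nOx] := pselect (Omega x); last by exists 0.
    have [r [r0 rO mr H]] := W1n_local_box n0 oO W Ox; exists r => _; split=> //.
    have mB := @measurable_ball_Rn R n x r.
    have mf : measurable_fun (ball x r) (fun y => expR (2 * phi y)).
      have m2 : measurable_fun (ball x r) (fun y => 2 * phi y).
        by apply: measurable_funM mr; exact: measurable_cst.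
      by apply: measurableT_comp m2; exact: measurable_expR.
    apply: (subset_integrable_fin (measurableI _ _ mV mB) mB (@subIsetr _ _ _) mf).
      by move=> y; exact: expR_ge0.
    have := H 1; rewrite normr1 => /(_ erefl).
    by under eq_integral do rewrite mul1r.
  have [cV cVO] := VO.
  move: cV; rewrite compact_cover => /(_ Rn (closure V) (fun x => ball x (r x))).
  case.
  - by move=> x _; exact: ball_open.
  - by move=> x xV; exists x => //; have [r0 _] := rP x (cVO _ xV); exact: ballxx.
  - move=> D DV Dcov.
    have := @finite_cover_integral_lty V (fun x => expR (2 * phi x)) (finmap.enum_fset D)
        r mV mexp2.
    apply.
    + by move=> x; exact: expR_ge0.
    + by move=> x xD; have [] := rP x (cVO _ (set_mem (DV x xD))).
    + by move=> y /subset_closure /Dcov[x xD xy]; exists x.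
rewrite /Lp inE; apply/andP; split; rewrite inE/=.
  exact/(measurable_restrictT _ mV).
rewrite /finite_norm unlock /Lnorm; apply: poweR_lty.
suff -> : (\int[mu]_x `|(EFin \o ((fun x => expR (phi x)) \_ V)) x| `^ 2 =
   \int[mu]_(x in V) (expR (2 * phi x))%:E)%E by [].
rewrite [RHS]integral_mkcond; apply: eq_integral => x _.
rewrite /= !patchE; case: ifP => _; last by rewrite normr0 powR0.
by rewrite powR_mulrn// expR_sqr.
Qed.

Lemma euclidean_ball_sub_ball (x0 : Rn) (r : R) : 0 < r ->
    euclidean_ball x0 r `<=` ball x0 r.
Proof.
move=> r0 x /= xr; split=> // i j; rewrite (ord1 i) /ball/= distrC.
apply: le_lt_trans xr; rewrite -sqrtr_sqr; apply: ler_wsqrtr.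
by rewrite (bigD1 j)//= lerDl sumr_ge0// => k _; exact: sqr_ge0.
Qed.

Lemma measurable_euclidean_ball (x0 : Rn) (r : R) : measurable (euclidean_ball x0 r).
Proof.
apply: open_measurable_Rn.
have cf : continuous (fun x : Rn => Num.sqrt (\sum_(i < n) (x ord0 i - x0 ord0 i) ^+ 2)).
  move=> x; apply: continuous_comp; last exact: sqrt_continuous.
  have := @continuous_big R _ +%R 0 xpredT (@add_continuous _) _ (index_enum 'I_n)
    (fun (i : 'I_n) (y : Rn) => (y ord0 i - x0 ord0 i) ^+ 2); apply => i _ y.
  apply: (@continuous_comp _ _ _ (fun y : Rn => y ord0 i - x0 ord0 i) (fun t => t ^+ 2));
      last exact: exprn_continuous.
  have ci : continuous (fun z : Rn => z ord0 i) by exact: coord_continuous.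
  rewrite /prop_for /continuous_at.
  apply: (@cvgB _ R^o _ _ (nbhs_filter y) (fun z : Rn => z ord0 i) (fun=> x0 ord0 i)).
    exact: ci.
  exact: cvg_cst.
rewrite (_ : euclidean_ball _ _ = (fun x : Rn => Num.sqrt (\sum_(i < n) (x ord0 i - x0
    ord0 i) ^+ 2)) @^-1` `]-oo, r[%classic).
  by move/continuousP : cf; apply; exact: interval_open.
by apply/seteqP; split => x /=; rewrite in_itv.
Qed.

(** With half side [h = r / (2 * n)] the squared distance to the centre is at most
    [n * h ^+ 2 = r ^+ 2 / (4 * n)]. On this cube the volume is explicit and proportional to
    [r ^+ n]. *)
Lemma cube_sub_euclidean_ball (x0 : Rn) (r : R) : (0 < n)%N -> 0 < r ->
  box (fun j => x0 ord0 j - r / (2 * n%:R)) (fun=> r / n%:R) `<=` euclidean_ball x0 r.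
Proof.
move=> n0 r0 x xB; have nR0 : 0 < n%:R :> R by rewrite ltr0n.
have n1 : 1 <= n%:R :> R by rewrite ler1n.
rewrite /euclidean_ball /= -[X in _ < X](@gtr0_norm _ r)// -sqrtr_sqr ltr_sqrt ?exprn_gt0//.
set h := r / (2 * n%:R).
have h0 : 0 < h by rewrite divr_gt0// mulr_gt0.
have rn : r / n%:R = h + h by rewrite /h; field; rewrite gt_eqF.
apply: (@le_lt_trans _ _ (\sum_(i < n) h ^+ 2)).
  apply: ler_sum => i _; have /andP[h1 h2] := xB i.
  rewrite -/h in h1 h2; rewrite rn in h2.
  rewrite -[leLHS]real_normK ?num_real// ler_sqr ?nnegrE ?(ltW h0)//.
  by rewrite ler_norml; apply/andP; split; lra.
rewrite sumr_const card_ord -mulr_natl.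
have E : n%:R * h ^+ 2 = r ^+ 2 / (4 * n%:R) by rewrite /h; field; rewrite gt_eqF.
rewrite E ltr_pdivrMr ?mulr_gt0// ltr_pMr ?exprn_gt0//; lra.
Qed.

End exponential_of_W1n.

(** * Lower bound of the integral over small balls *)

Section finite_order.
Variables (R : realType) (n : nat).
Local Notation Rn := 'rV[R]_n.
Local Notation mu := (@lebesgue_Rn R n).

(* [1 = e^phi e^-phi] and Cauchy-Schwarz, in the form [2 s <= e^(2 phi) + s^2 e^(-2 phi)]
   optimized over [s]. *)
Lemma expR_integral_ge (phi : Rn -> R) (a l : 'I_n -> R) (J : R) :
  (forall j, 0 < l j) -> 0 < J -> measurable_fun (box a l) phi ->
  (\int[mu]_(x in box a l) (expR (- (2 * phi x)))%:E <= J%:E)%E ->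
  ((vol l ^+ 2 / J)%:E <= \int[mu]_(x in box a l) (expR (2 * phi x))%:E)%E.
Proof.
move=> l0 J0 mphi HJ; have mq := @measurable_box R n a l.
have v0 := vol_gt0 l0; pose s := vol l / J.
have s0 : 0 < s by rewrite divr_gt0.
have m2 : measurable_fun (box a l) (fun x => 2 * phi x).
  by apply: measurable_funM mphi; exact: measurable_cst.
have mE : measurable_fun (box a l) (fun x => (expR (2 * phi x))%:E).
  by apply/measurable_EFinP; apply: measurableT_comp m2; exact: measurable_expR.
have mN : measurable_fun (box a l) (fun x => (expR (- (2 * phi x)))%:E).
  apply/measurable_EFinP; apply: measurableT_comp (measurable_funN m2).
  exact: measurable_expR.
have E0 x : box a l x -> (0 <= (expR (2 * phi x))%:E)%E by rewrite lee_fin expR_ge0.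
have N0 x : box a l x -> (0 <= (expR (- (2 * phi x)))%:E)%E by rewrite lee_fin expR_ge0.
have ss0 : (0 <= (s ^+ 2)%:E)%E by rewrite lee_fin exprn_ge0// ltW.
have msN := measurable_funeM (s ^+ 2)%:E mN.
have sN0 x : box a l x -> (0 <= (s ^+ 2)%:E * (expR (- (2 * phi x)))%:E)%E.
  by move=> _; rewrite mule_ge0.
have cst0 x : box a l x -> (0 <= (2 * s)%:E)%E.
  by move=> _; rewrite lee_fin mulr_ge0// ltW.
have mc : measurable_fun (box a l) (fun=> (2 * s)%:E) by exact: measurable_cst.
have le x : box a l x ->
    ((2 * s)%:E <= (expR (2 * phi x))%:E + (s ^+ 2)%:E * (expR (- (2 * phi x)))%:E)%E.
  move=> _; rewrite -EFinM -EFinD lee_fin -mulrN !expRM_natl expRN.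
  have := expR_gt0 (phi x); set e := expR _ => e0.
  have := sqr_ge0 (e - s / e).
  have -> : (e - s / e) ^+ 2 = e ^+ 2 + s ^+ 2 * (e^-1) ^+ 2 - 2 * s by field;
      rewrite gt_eqF.
  lra.
have := ge0_le_integral mu mq cst0 mc (emeasurable_funD mE msN) le.
rewrite (integral_cst mu mq) /= lebesgue_Rn_box// -/(vol l).
rewrite (ge0_integralD mu mq E0 mE sN0 msN) (ge0_integralZl mu mq mN N0 ss0) => H.
have {}H : ((2 * s * vol l)%:E <= \int[mu]_(x in box a l) (expR (2 * phi x))%:E +
    (s ^+ 2 * J)%:E)%E.
  rewrite EFinM (le_trans H)//; apply: leeD => //.
  by rewrite [leRHS]EFinM; exact: (lee_wpmul2l ss0 HJ).
rewrite (_ : vol l ^+ 2 / J = 2 * s * vol l - s ^+ 2 * J); last first.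
  by rewrite /s; field; rewrite gt_eqF.
by rewrite EFinB leeBlDr.
Qed.

Lemma expR_finite_order (Omega : set Rn) (phi : Rn -> R) (x0 : Rn) : (0 < n)%N ->
  open Omega -> W1p_loc Omega n%:R phi -> Omega x0 ->
  vanishes_to_finite_order Omega (fun x => expR (phi x)) x0.
Proof.
(* The order [2 * n] is that of the square of the volume of a cube of side [r / n]: the powers of
   [r] cancel and leave the positive constant [kap]. *)
move=> n0 oO W Ox; move/(_ (2 * n)%N).
have [rho [rho0 rhoO mphi H]] := W1n_local_box n0 oO W Ox.
have nR0 : 0 < n%:R :> R by rewrite ltr0n.
have mBr := @measurable_ball_Rn R n x0 rho.
have HN : (\int[mu]_(x in ball x0 rho) (expR (- (2 * phi x)))%:E < +oo)%E.
  have := H (-1); rewrite normrN1 => /(_ erefl).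
  by under eq_integral do rewrite mulN1r mulrN.
(* The summand 1 makes [J] positive, so that it may be divided by. *)
pose J : R := fine (\int[mu]_(x in ball x0 rho) (expR (- (2 * phi x)))%:E) + 1.
have IN0 : (0 <= \int[mu]_(x in ball x0 rho) (expR (- (2 * phi x)))%:E)%E.
  by apply: integral_ge0 => x _; rewrite lee_fin expR_ge0.
have J0 : 0 < J by rewrite ltr_wpDl// fine_ge0.
have HJ : (\int[mu]_(x in ball x0 rho) (expR (- (2 * phi x)))%:E <= J%:E)%E.
  by rewrite /J EFinD fineK ?ge0_fin_numE// leeDl.
pose kap : R := n%:R^-1 ^+ (2 * n) / J.
have kap0 : 0 < kap by rewrite divr_gt0// exprn_gt0// invr_gt0.
move=> lim0; suff : (kap%:E <= 0)%E by rewrite lee_fin leNgt kap0.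
apply: (cvge_to_ge lim0); near=> r.
have r0 : 0 < r by near: r; exact: nbhs_right_gt.
have rrho : r < rho by near: r; exact: nbhs_right_lt.
pose l : 'I_n -> R := fun=> r / n%:R.
pose a j := x0 ord0 j - r / (2 * n%:R).
have l0 (j : 'I_n) : 0 < l j by rewrite /l divr_gt0.
have mq := @measurable_box R n a l.
have qE : box a l `<=` euclidean_ball x0 r by exact: cube_sub_euclidean_ball.
have Erho : euclidean_ball x0 r `<=` ball x0 rho.
  by apply: (subset_trans (euclidean_ball_sub_ball r0)); exact: le_ball (ltW rrho).
have qrho := subset_trans qE Erho.
have mphiq : measurable_fun (box a l) phi by exact: measurable_funS mBr qrho mphi.
have mN : measurable_fun (ball x0 rho) (fun x => (expR (- (2 * phi x)))%:E).
  have m2 : measurable_fun (ball x0 rho) (fun x => 2 * phi x).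
    by apply: measurable_funM mphi; exact: measurable_cst.
  apply/measurable_EFinP; apply: measurableT_comp (measurable_funN m2).
  exact: measurable_expR.
have HJq : (\int[mu]_(x in box a l) (expR (- (2 * phi x)))%:E <= J%:E)%E.
  apply: le_trans HJ; apply: (ge0_subset_integral mu mq mBr mN _ qrho) => x _.
  by rewrite lee_fin expR_ge0.
have Hge := expR_integral_ge l0 J0 mphiq HJq.
have mOE : measurable (Omega `&` euclidean_ball x0 r).
  by apply: measurableI; [exact: open_measurable_Rn|exact: measurable_euclidean_ball].
have mphiE : measurable_fun (Omega `&` euclidean_ball x0 r) phi.
  by apply: measurable_funS mphi => // x [_ /Erho].
have mu2 : measurable_fun (Omega `&` euclidean_ball x0 r) (fun x => (`|expR (phi x)| ^+
    2)%:E).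
  under eq_fun do rewrite expR_sqr.
  have m2 : measurable_fun (Omega `&` euclidean_ball x0 r) (fun x => 2 * phi x).
    by apply: measurable_funM mphiE; exact: measurable_cst.
  by apply/measurable_EFinP; apply: measurableT_comp m2; exact: measurable_expR.
have qOE : box a l `<=` Omega `&` euclidean_ball x0 r.
  by move=> x xq; split; [exact/rhoO/qrho|exact: qE].
have big : ((vol l ^+ 2 / J)%:E <=
    \int[mu]_(x in Omega `&` euclidean_ball x0 r) (`|expR (phi x)| ^+ 2)%:E)%E.
  apply: (le_trans Hge).
  have -> : (\int[mu]_(x in box a l) (expR (2 * phi x))%:E =
      \int[mu]_(x in box a l) (`|expR (phi x)| ^+ 2)%:E)%E.
    by apply: eq_integral => x _; rewrite expR_sqr.
  apply: (ge0_subset_integral mu mq mOE mu2 _ qOE) => x _.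
  by rewrite lee_fin exprn_ge0.
have rm0 : (0 <= (r ^- (2 * n))%:E)%E by rewrite lee_fin invr_ge0 exprn_ge0// ltW.
apply: le_trans (lee_wpmul2l rm0 big).
rewrite -EFinM lee_fin /kap /vol /l prodr_const card_ord.
rewrite -exprM mulnC exprMn mulrA mulrA mulVf ?mul1r//.
by rewrite expf_neq0// gt_eqF.
Unshelve. all: by end_near. Qed.

End finite_order.

Unset Implicit Arguments.

Theorem theorem1p2 (R : realType) (n : nat) (Omega : set 'rV[R]_n)
    (phi : 'rV[R]_n -> R) :
  (2 <= n)%N -> open Omega -> W1p_loc Omega n%:R phi ->
  Lp_loc Omega 2 (fun x => expR (phi x)) /\
  forall x0 : 'rV[R]_n, Omega x0 ->
    vanishes_to_finite_order Omega (fun x => expR (phi x)) x0.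
Proof.
move=> /ltnW n0 oO W; split; first exact: expR_Lp2_loc.
by move=> x0; exact: expR_finite_order.
Qed.
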